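(* Let $\Phi$ and $\Psi$ be Turing functionals such that $\lambda_\Phi=\lambda_\Psi$ and $\lambda_\Phi$ is a computable semi-measure. Then $\Phi(\mathsf{MLR})=\Psi(\mathsf{MLR})$.
   Context: $2^\omega$ is Cantor space, $2^{<\omega}$ the set of finite binary strings, $\preceq$ the prefix order, $\varepsilon$ the empty string, and $\lambda$ the uniform (Lebesgue) measure on $2^\omega$. A Turing functional $\Phi$ is a c.e. set of pairs $(\sigma,\tau)$ of strings such that whenever $(\sigma,\tau),(\sigma',\tau')\in\Phi$ and $\sigma\preceq\sigma'$, the strings $\tau,\tau'$ are $\preceq$-comparable. For $X\in2^\omega$, $\Phi^X$ is the $\preceq$-maximal finite or infinite sequence extending every $\tau$ with $(\sigma,\tau)\in\Phi$ for some $\sigma\preceq X$; $\mathrm{dom}(\Phi)=\{X:\Phi^X\text{ is infinite}\}$, and for $X\in\mathrm{dom}(\Phi)$ we write $\Phi(X)=\Phi^X$. For $A\subseteq 2^\omega$, $\Phi(A)=\{\Phi(X):X\in A\cap\mathrm{dom}(\Phi)\}$. The semi-measure induced by $\Phi$ is $\lambda_\Phi(\sigma)=\lambda(\{X:\Phi^X\succeq\sigma\})$. A semi-measure is a function $\rho:2^{<\omega}\to[0,1]$ with $\rho(\varepsilon)=1$ and $\rho(\sigma)\ge\rho(\sigma0)+\rho(\sigma1)$; it is computable if there is a computable $\tilde\rho:2^{<\omega}\times\omega\to\mathbb{Q}$ with $|\rho(\sigma)-\tilde\rho(\sigma,i)|\le 2^{-i}$ for all $\sigma,i$. $\mathsf{MLR}$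 is the set of Martin-Löf random sequences with respect to $\lambda$. *)

(* Defs.v *)
From Stdlib Require Import Reals List Arith Cantor.
From Coquelicot Require Import Coquelicot.
Import ListNotations.
Open Scope R_scope.

Inductive rcode : Type :=
| RZero : rcode
| RSucc : rcode
| RProj : nat -> rcode
| RComp : rcode -> list rcode -> rcode
| RPrec : rcode -> rcode -> rcode
| RMu   : rcode -> rcode.

Inductive reval : rcode -> list nat -> nat -> Prop :=
| ev_zero v : reval RZero v 0
| ev_succ v : reval RSucc v (S (nth 0 v 0%nat))
| ev_proj i v : reval (RProj i) v (nth i v 0%nat)
| ev_comp f gs v ws y :
    revalL gs v ws -> reval f ws y -> reval (RComp f gs) v y
| ev_prec0 f g v y : reval f v y -> reval (RPrec f g) (0%nat :: v) y
| ev_precS f g n v z y :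
    reval (RPrec f g) (n :: v) z -> reval g (n :: z :: v) y ->
    reval (RPrec f g) (S n :: v) y
| ev_mu f v n :
    reval f (n :: v) 0 ->
    (forall m, (m < n)%nat -> exists k, reval f (m :: v) (S k)) ->
    reval (RMu f) v n
with revalL : list rcode -> list nat -> list nat -> Prop :=
| evL_nil v : revalL [] v []
| evL_cons g gs v y ys :
    reval g v y -> revalL gs v ys -> revalL (g :: gs) v (y :: ys).

Definition computable_fun (f : nat -> nat) : Prop :=
  exists c : rcode, forall n, reval c [n] (f n).

Definition ce_set (A : nat -> Prop) : Prop :=
  exists c : rcode, forall n, A n <-> exists y, reval c [n] y.

Definition str := list bool.

(* binary string s |-> (number with binary expansion 1s) - 1 : a bijection str -> nat *)
Definition code_str (s : str) : nat :=
  (fold_left (fun acc (b : bool) => 2 * acc + (if b then 1 else 0)) s 1%nat - 1)%nat.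

Definition npair (a b : nat) : nat := Cantor.to_nat (a, b).

Definition code_pair (s t : str) : nat := npair (code_str s) (code_str t).

(* nat -> Q (as a real), surjective onto the rationals:
   n = <<sgn, a>, b>  |->  (-1)^[sgn<>0] * a / (b+1) *)
Definition dec_rat (n : nat) : R :=
  let (p, b) := Cantor.of_nat n in
  let (sg, a) := Cantor.of_nat p in
  (if Nat.eqb sg 0 then 1 else -1) * INR a / INR (S b).

Definition cantor := nat -> bool.

Definition pre (s : str) (X : cantor) : Prop :=
  forall i, (i < length s)%nat -> X i = nth i s false.

Definition spre (s t : str) : Prop := exists r, t = s ++ r.

Definition covers (A : cantor -> Prop) (f : nat -> option str) : Prop :=
  forall X, A X -> exists n s, f n = Some s /\ pre s X.

Definition cyl_weight (f : nat -> option str) (n : nat) : R :=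
  match f n with Some s => (/2) ^ length s | None => 0 end.

(* Lebesgue outer measure on 2^omega: infimum of the total weight of
   countable cylinder covers. Agrees with lambda on all measurable sets. *)
Definition lam (A : cantor -> Prop) : R :=
  real (Glb_Rbar (fun r => exists f, covers A f /\ is_series (cyl_weight f) r)).

Definition cylset (U : str -> Prop) : cantor -> Prop :=
  fun X => exists s, U s /\ pre s X.

Definition turing_functional (Phi : str -> str -> Prop) : Prop :=
  ce_set (fun n => exists s t, n = code_pair s t /\ Phi s t) /\
  (forall s t s' t', Phi s t -> Phi s' t' -> spre s s' -> spre t t' \/ spre t' t).

(* [out Phi X i b]: the i-th bit of Phi^X (the maximal sequence extending
   every tau with (sigma,tau) in Phi, sigma ⪯ X) is defined and equals b *)
Definition out (Phi : str -> str -> Prop) (X : cantor) (i : nat) (b : bool) : Prop :=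
  exists s t, Phi s t /\ pre s X /\ (i < length t)%nat /\ nth i t false = b.

Definition out_ext (Phi : str -> str -> Prop) (X : cantor) (s : str) : Prop :=
  forall i, (i < length s)%nat -> out Phi X i (nth i s false).

Definition in_dom (Phi : str -> str -> Prop) (X : cantor) : Prop :=
  forall i, exists b, out Phi X i b.

Definition image (Phi : str -> str -> Prop) (A : cantor -> Prop) : cantor -> Prop :=
  fun Y => exists X, A X /\ in_dom Phi X /\ forall i, out Phi X i (Y i).

Definition lam_Phi (Phi : str -> str -> Prop) (s : str) : R :=
  lam (fun X => out_ext Phi X s).

Definition semimeasure (rho : str -> R) : Prop :=
  (forall s, 0 <= rho s <= 1) /\ rho [] = 1 /\
  (forall s, rho s >= rho (s ++ [false]) + rho (s ++ [true])).

Definition computable_semimeasure (rho : str -> R) : Prop :=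
  semimeasure rho /\
  exists g : nat -> nat, computable_fun g /\
    forall s i, Rabs (rho s - dec_rat (g (npair (code_str s) i))) <= (/2) ^ i.

Definition ML_test (W : nat -> Prop) : Prop :=
  ce_set W /\
  forall n, lam (cylset (fun s => W (npair n (code_str s)))) <= (/2) ^ n.

Definition MLR (X : cantor) : Prop :=
  forall W, ML_test W -> ~ (forall n, cylset (fun s => W (npair n (code_str s))) X).

(* Main.v *)
(** Write [O(u)] for the open set of all [X] with [Psi^X] extending [u]. As its measure
    is computable, one finds effectively a clopen [C_i(u)] inside [O(u)] such that the
    remainders [O(u) \ C_i(u)], over all [u], have total measure at most [2^-(i+1)].
    Adding them to the [i]-th level of a universal Martin-Löf test gives a test [U_i]
    outside of which [O(u)] and the closed set [C_i(u)] coincide. Let [G_i] be the set of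
    [u] with [C_i(u)] contained in [U_i], which is c.e. by compactness.

    If [Y] has no random [Psi]-preimage, then for every [i] the decreasing closed sets
    [C_i(Y|n) \ U_i] have empty intersection, so by compactness some [Y|n] lies in [G_i].
    The union of [O(u)] over [u] in [G_i] is contained in [U_i] and hence has measure at
    most [2^-i]; its measure is a sum of values of [lambda_Psi = lambda_Phi] over the
    minimal elements of [G_i], so the sets of [X] with [Phi^X] extending an element of
    [G_i] form a Martin-Löf test as well. It captures every [Phi]-preimage of [Y]. *)

From Stdlib Require Import Reals List Arith Cantor Lia Lra Classical ClassicalEpsilon.
From Stdlib Require Import FunctionalExtensionality PropExtensionality.
From Coquelicot Require Import Coquelicot.
Require Import Defs.
Import ListNotations.
Open Scope nat_scope.

(** * Computable functions, decidable predicates and [Sigma_1] predicates *)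

(** In general [lam_Phi] is only a semi-measure: mass may be lost along [Y], so there is no evident
    measure for which [Y] itself could be called random. Randomness is therefore tested on inputs
    only, and the two functionals communicate through sets of output strings. Two obstacles shape
    the construction. Inclusion of an open set in a c.e. open set is not a c.e. condition, and a
    decreasing sequence of open sets may have empty intersection. Neither problem occurs for clopen
    sets, and computability of the measure is what allows an open set to be replaced by a clopen one
    at a controlled cost. The random sequences do not form a compact set either, only a countable
    union of compact ones, so the argument always works outside one fixed level of the universal
    test. The budget at level [i] is split in two halves of [2^-(i+1)]. One goes to the universal
    test. The other is divided among all strings, the string with code [a] receiving
    [2^-(a+i+2)]. *)

Definition p1 (n : nat) : nat := fst (Cantor.of_nat n).
Definition p2 (n : nat) : nat := snd (Cantor.of_nat n).

Lemma p1_npair a b : p1 (npair a b) = a.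
Proof. unfold p1, npair. now rewrite Cantor.cancel_of_to. Qed.

Lemma p2_npair a b : p2 (npair a b) = b.
Proof. unfold p2, npair. now rewrite Cantor.cancel_of_to. Qed.

Lemma npair_p1_p2 n : npair (p1 n) (p2 n) = n.
Proof.
  unfold npair, p1, p2.
  rewrite <- surjective_pairing. apply Cantor.cancel_to_of.
Qed.

Lemma npair_inj a b c d : npair a b = npair c d -> a = c /\ b = d.
Proof.
  intros H. split.
  - now rewrite <- (p1_npair a b), H, p1_npair.
  - now rewrite <- (p2_npair a b), H, p2_npair.
Qed.

Lemma dec_rat_eq n :
  dec_rat n = ((if Nat.eqb (p1 (p1 n)) 0 then 1 else -1) * INR (p2 (p1 n)) / INR (S (p2 n)))%R.
Proof.
  unfold dec_rat, p1, p2. destruct (Cantor.of_nat n) as [p b]. simpl fst.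
  now destruct (Cantor.of_nat p).
Qed.

#[global] Opaque p1 p2.

Definition computable2 (F : nat -> nat -> nat) : Prop :=
  exists c, forall a b, reval c [a; b] (F a b).

Lemma computable_ext f g :
  (forall n, f n = g n) -> computable_fun f -> computable_fun g.
Proof. intros H [c Hc]. exists c. intros n. rewrite <- H. apply Hc. Qed.

Lemma computable_id : computable_fun (fun x => x).
Proof. exists (RProj 0). intros n. apply (ev_proj 0 [n]). Qed.

Lemma computable_const k : computable_fun (fun _ => k).
Proof.
  induction k as [|k [c Hc]].
  - exists RZero. intros n. constructor.
  - exists (RComp RSucc [c]). intros n.
    apply ev_comp with [k]; [repeat constructor; apply Hc | apply (ev_succ [k])].
Qed.

Lemma computable_comp f g :
  computable_fun f -> computable_fun g -> computable_fun (fun x => f (g x)).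
Proof.
  intros [cf Hf] [cg Hg]. exists (RComp cf [cg]). intros n.
  apply ev_comp with [g n]; [repeat constructor; apply Hg | apply Hf].
Qed.

Lemma computable_comp2 F f g :
  computable2 F -> computable_fun f -> computable_fun g ->
  computable_fun (fun x => F (f x) (g x)).
Proof.
  intros [c Hc] [cf Hf] [cg Hg]. exists (RComp c [cf; cg]). intros n.
  apply ev_comp with [f n; g n]; [repeat constructor; auto | apply Hc].
Qed.

Lemma computable_succ f : computable_fun f -> computable_fun (fun x => S (f x)).
Proof.
  apply computable_comp with (f := S). exists RSucc. intros n. apply (ev_succ [n]).
Qed.

Lemma computable2_add : computable2 Nat.add.
Proof.
  exists (RPrec (RProj 0) (RComp RSucc [RProj 1])). intros a b.
  induction a as [|a IH]; simpl.
  - apply ev_prec0, (ev_proj 0 [b]).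
  - apply ev_precS with (a + b); [exact IH|].
    apply ev_comp with [a + b]; [|apply (ev_succ [a + b])].
    repeat constructor.
Qed.

Lemma computable_pred : computable_fun pred.
Proof.
  exists (RPrec RZero (RProj 0)). intros n.
  induction n as [|n IH]; simpl; [repeat constructor|].
  apply ev_precS with (pred n); [exact IH|].
  apply (ev_proj 0 [n; pred n]).
Qed.

Lemma computable2_flip F : computable2 F -> computable2 (fun a b => F b a).
Proof.
  intros [c Hc]. exists (RComp c [RProj 1; RProj 0]). intros a b.
  apply ev_comp with [b; a]; [|apply Hc].
  repeat constructor.
Qed.

Lemma computable2_sub : computable2 Nat.sub.
Proof.
  (* [RPrec] recurses on its first argument, which has to be the subtrahend. *)
  apply (computable2_flip (fun a b => b - a)).
  destruct computable_pred as [c Hc].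
  exists (RPrec (RProj 0) (RComp c [RProj 1])). intros a b.
  induction a as [|a IH].
  - rewrite Nat.sub_0_r. constructor. apply (ev_proj 0 [b]).
  - apply ev_precS with (b - a); [exact IH|].
    apply ev_comp with [b - a].
    + repeat constructor.
    + replace (b - S a) with (pred (b - a)) by lia. apply Hc.
Qed.

(** Copied from the recursion inside [Cantor.to_nat], which makes [npair_triangle] hold by
    computation. *)
Definition triangle (n : nat) : nat := nat_rec _ 0 (fun i m => S i + m) n.

Lemma npair_triangle a b : npair a b = b + triangle (b + a).
Proof. reflexivity. Qed.

Lemma computable_triangle : computable_fun triangle.
Proof.
  destruct computable2_add as [c Hc].
  exists (RPrec RZero (RComp c [RComp RSucc [RProj 0]; RProj 1])). intros n.
  induction n as [|n IH]; [repeat constructor|].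
  apply ev_precS with (triangle n); [exact IH|].
  apply ev_comp with [S n; triangle n]; [|apply Hc].
  constructor; [|repeat constructor].
  apply ev_comp with [n]; [repeat constructor|].
  apply (ev_succ [n]).
Qed.

Lemma computable2_npair : computable2 npair.
Proof.
  destruct computable2_add as [ca Ha]. destruct computable_triangle as [ct Ht].
  exists (RComp ca [RProj 1; RComp ct [RComp ca [RProj 1; RProj 0]]]). intros a b.
  apply ev_comp with [b; triangle (b + a)]; [|apply Ha].
  constructor; [apply (ev_proj 1 [a; b])|].
  constructor; [|constructor].
  apply ev_comp with [b + a]; [|apply Ht].
  constructor; [|constructor].
  apply ev_comp with [b; a]; [|apply Ha].
  repeat constructor.
Qed.

Lemma least_zero (f : nat -> nat) :
  (exists n, f n = 0) -> exists n, f n = 0 /\ forall m, m < n -> f m <> 0.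
Proof.
  intros [n Hn]. induction n as [n IH] using (well_founded_induction lt_wf).
  destruct (classic (exists m, m < n /\ f m = 0)) as [[m [Hm H0]]|H].
  - exact (IH m Hm H0).
  - exists n. split; [exact Hn|]. intros m Hm H0. apply H. now exists m.
Qed.

Lemma computable_least F :
  computable2 F -> (forall x, exists n, F n x = 0) ->
  exists h, computable_fun h /\
    forall x, F (h x) x = 0 /\ forall m, m < h x -> F m x <> 0.
Proof.
  intros [c Hc] Hex.
  destruct (choice (fun x n => F n x = 0 /\ forall m, m < n -> F m x <> 0)) as [h Hh].
  { intros x. apply (least_zero (fun n => F n x)), Hex. }
  exists h. split; [|exact Hh].
  exists (RMu c). intros x. destruct (Hh x) as [H0 Hlt].
  constructor.
  - rewrite <- H0. apply Hc.
  - intros m Hm. exists (pred (F m x)).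
    replace (S (pred (F m x))) with (F m x) by (specialize (Hlt m Hm); lia).
    apply Hc.
Qed.

Lemma triangle_S n : triangle (S n) = S n + triangle n.
Proof. reflexivity. Qed.

Lemma triangle_mono a b : a <= b -> triangle a <= triangle b.
Proof. induction 1; rewrite ?triangle_S; lia. Qed.

(** The sum [p2 n + p1 n] is the index of the Cantor diagonal through [n], the least [w] with
    [n < triangle (S w)], and is found by search. Then [p2 n] is the offset of [n] from the start of
    its diagonal. *)
Lemma computable_p1_p2 : computable_fun p1 /\ computable_fun p2.
Proof.
  destruct (computable_least (fun w n => S n - triangle (S w))) as [h [Hc Hh]].
  - destruct computable2_sub as [cs Hs]. destruct computable_triangle as [ct Ht].
    exists (RComp cs [RComp RSucc [RProj 1]; RComp ct [RComp RSucc [RProj 0]]]).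
    intros a b. apply ev_comp with [S b; triangle (S a)]; [|apply Hs].
    constructor; [|constructor; [|constructor]].
    + apply ev_comp with [b]; [repeat constructor|].
      apply (ev_succ [b]).
    + apply ev_comp with [S a]; [|apply Ht].
      constructor; [|constructor].
      apply ev_comp with [a]; [repeat constructor|].
      apply (ev_succ [a]).
  - intros x. exists x. rewrite triangle_S. lia.
  - assert (Hsum : forall n, h n = p2 n + p1 n).
    { intros n. destruct (Hh n) as [H0 Hlt].
      pose proof (npair_p1_p2 n) as Hn. rewrite npair_triangle in Hn.
      set (s := p2 n + p1 n) in *.
      assert (p2 n <= s) by (unfold s; lia).
      destruct (lt_eq_lt_dec (h n) s) as [[Hl|He]|Hg]; auto; exfalso.
      - pose proof (triangle_mono (S (h n)) s Hl). lia.
      - apply (Hlt s Hg). rewrite triangle_S. lia. }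
    assert (Hp2 : computable_fun p2).
    { apply computable_ext with (fun n => n - triangle (h n)).
      - intros n. rewrite Hsum. pose proof (npair_p1_p2 n) as Hn.
        rewrite npair_triangle in Hn. lia.
      - apply (computable_comp2 Nat.sub); [apply computable2_sub|apply computable_id|].
        apply computable_comp; [apply computable_triangle|exact Hc]. }
    split; [|exact Hp2].
    apply computable_ext with (fun n => h n - p2 n).
    + intros n. rewrite Hsum. lia.
    + apply (computable_comp2 Nat.sub); auto using computable2_sub.
Qed.

Lemma computable_p1 f : computable_fun f -> computable_fun (fun x => p1 (f x)).
Proof. apply (computable_comp p1), computable_p1_p2. Qed.

Lemma computable_p2 f : computable_fun f -> computable_fun (fun x => p2 (f x)).
Proof. apply (computable_comp p2), computable_p1_p2. Qed.

Lemma computable_npair f g :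
  computable_fun f -> computable_fun g -> computable_fun (fun x => npair (f x) (g x)).
Proof. apply (computable_comp2 npair), computable2_npair. Qed.

Lemma computable_add f g :
  computable_fun f -> computable_fun g -> computable_fun (fun x => f x + g x).
Proof. apply (computable_comp2 Nat.add), computable2_add. Qed.

Lemma computable_sub f g :
  computable_fun f -> computable_fun g -> computable_fun (fun x => f x - g x).
Proof. apply (computable_comp2 Nat.sub), computable2_sub. Qed.

Lemma computable_predn f : computable_fun f -> computable_fun (fun x => pred (f x)).
Proof. apply (computable_comp pred), computable_pred. Qed.

(** [computable_fun] is unary, so functions of several variables are treated as functions of one
    paired argument; this is the form that hypotheses take from here on. *)
Lemma computable_app2 (F : nat -> nat -> nat) f g :
  computable_fun (fun z => F (p1 z) (p2 z)) ->
  computable_fun f -> computable_fun g -> computable_fun (fun x => F (f x) (g x)).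
Proof.
  intros HF Hf Hg.
  apply computable_ext with (fun x => (fun z => F (p1 z) (p2 z)) (npair (f x) (g x))).
  - intros n. cbv beta. now rewrite p1_npair, p2_npair.
  - apply (computable_comp _ _ HF), computable_npair; assumption.
Qed.

(** In the hypothesis on [b] the paired argument holds the stage, the previous value and the
    parameter, in this order. *)
Lemma computable_rec (a n : nat -> nat) (b : nat -> nat -> nat -> nat) :
  computable_fun a -> computable_fun n ->
  computable_fun (fun z => b (p2 (p2 z)) (p1 z) (p1 (p2 z))) ->
  computable_fun (fun x => nat_rect (fun _ => nat) (a x) (b x) (n x)).
Proof.
  intros [ca Ha] [cn Hn] [cb Hb]. destruct computable2_npair as [cp Hp].
  exists (RComp (RPrec ca (RComp cb [RComp cp [RProj 0; RComp cp [RProj 1; RProj 2]]]))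
            [cn; RProj 0]).
  intros x. apply ev_comp with [n x; x].
  { repeat constructor. apply Hn. }
  induction (n x) as [|k IH]; cbn [nat_rect]; [constructor; apply Ha|].
  set (r := nat_rect _ _ _ k) in *.
  apply ev_precS with r; [exact IH|].
  apply ev_comp with [npair k (npair r x)].
  - constructor; [|constructor].
    apply ev_comp with [k; npair r x]; [|apply Hp].
    constructor; [apply (ev_proj 0 [k; r; x])|constructor; [|constructor]].
    apply ev_comp with [r; x]; [|apply Hp].
    repeat constructor.
  - specialize (Hb (npair k (npair r x))).
    now rewrite !p2_npair, !p1_npair in Hb.
Qed.

Lemma computable_mul f g :
  computable_fun f -> computable_fun g -> computable_fun (fun x => f x * g x).
Proof.
  apply (computable_app2 Nat.mul).
  apply computable_ext with
    (fun z => nat_rect (fun _ => nat) 0 (fun _ r => p2 z + r) (p1 z)).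
  - intros z. induction (p1 z); simpl; auto.
  - apply (computable_rec (fun _ => 0) p1 (fun z _ r => p2 z + r));
      auto using computable_const, computable_p1, computable_p2, computable_id, computable_add.
Qed.

Lemma computable_pow2 f : computable_fun f -> computable_fun (fun x => 2 ^ f x).
Proof.
  intros Hf.
  apply computable_ext with (fun x => nat_rect (fun _ => nat) 1 (fun _ r => 2 * r) (f x)).
  - intros x. induction (f x); simpl; auto.
  - apply (computable_rec (fun _ => 1) f (fun _ _ r => 2 * r));
      auto using computable_const, computable_p1, computable_p2, computable_id, computable_mul.
Qed.

Fixpoint bsum (f : nat -> nat) (n : nat) : nat :=
  match n with 0 => 0 | S n => bsum f n + f n end.

Lemma bsum_zero f n : bsum f n = 0 <-> forall k, k < n -> f k = 0.
Proof.
  induction n as [|n IH]; simpl; [split; [lia|auto]|].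
  split.
  - intros H k Hk. destruct (Nat.eq_dec k n) as [->|]; [lia|]. apply IH; lia.
  - intros H. rewrite (proj2 IH); [rewrite H; lia|]. auto.
Qed.

Lemma computable_bsum (f : nat -> nat -> nat) b :
  computable_fun (fun z => f (p1 z) (p2 z)) -> computable_fun b ->
  computable_fun (fun x => bsum (fun k => f k x) (b x)).
Proof.
  intros Hf Hb.
  apply computable_ext with
    (fun x => nat_rect (fun _ => nat) 0 (fun k r => r + f k x) (b x)).
  - intros x. induction (b x); simpl; auto.
  - apply (computable_rec (fun _ => 0) b (fun x k r => r + f k x));
      auto 6 using computable_const, computable_p1, computable_p2, computable_id, computable_add.
    apply computable_add; [auto using computable_p1, computable_p2, computable_id|].
    apply (computable_app2 f _ _ Hf); auto using computable_p1, computable_p2, computable_id.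
Qed.

(** * Closure properties of decidable and c.e. predicates *)

Definition rdec (P : nat -> Prop) : Prop :=
  exists f, computable_fun f /\ forall x, P x <-> f x = 0.

(** As in [rdec], truth is the value 0: decidable conjunctions become sums, disjunctions become
    products, and the search for a witness is an application of [RMu]. *)
Definition sigma1 (P : nat -> Prop) : Prop :=
  exists f, computable_fun f /\ forall x, P x <-> exists t, f (npair x t) = 0.

Lemma rdec_ext P Q : (forall x, P x <-> Q x) -> rdec P -> rdec Q.
Proof. intros H [f [Hf HP]]. exists f. split; [exact Hf|]. intros x. now rewrite <- H. Qed.

Lemma rdec_subst P f : rdec P -> computable_fun f -> rdec (fun x => P (f x)).
Proof.
  intros [g [Hg HP]] Hf. exists (fun x => g (f x)).
  split; [now apply computable_comp|]. intros x. apply HP.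
Qed.

Lemma rdec_app2 (P : nat -> nat -> Prop) f g :
  rdec (fun z => P (p1 z) (p2 z)) -> computable_fun f -> computable_fun g ->
  rdec (fun x => P (f x) (g x)).
Proof.
  intros HP Hf Hg.
  apply rdec_ext with (fun x => (fun z => P (p1 z) (p2 z)) (npair (f x) (g x))).
  - intros x. cbv beta. now rewrite p1_npair, p2_npair.
  - apply (rdec_subst _ _ HP), computable_npair; assumption.
Qed.

Lemma rdec_app3 (P : nat -> nat -> nat -> Prop) f g h :
  rdec (fun z => P (p1 z) (p1 (p2 z)) (p2 (p2 z))) ->
  computable_fun f -> computable_fun g -> computable_fun h ->
  rdec (fun x => P (f x) (g x) (h x)).
Proof.
  intros HP Hf Hg Hh.
  apply rdec_ext with (fun x => (fun z => P (p1 z) (p1 (p2 z)) (p2 (p2 z)))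
                                  (npair (f x) (npair (g x) (h x)))).
  - intros x. cbv beta. now rewrite !p2_npair, !p1_npair.
  - apply (rdec_subst _ _ HP), computable_npair, computable_npair; assumption.
Qed.

Lemma rdec_and P Q : rdec P -> rdec Q -> rdec (fun x => P x /\ Q x).
Proof.
  intros [f [Hf HP]] [g [Hg HQ]]. exists (fun x => f x + g x).
  split; [now apply computable_add|]. intros x. rewrite HP, HQ. lia.
Qed.

Lemma rdec_or P Q : rdec P -> rdec Q -> rdec (fun x => P x \/ Q x).
Proof.
  intros [f [Hf HP]] [g [Hg HQ]]. exists (fun x => f x * g x).
  split; [now apply computable_mul|]. intros x. rewrite HP, HQ. nia.
Qed.

Lemma rdec_not P : rdec P -> rdec (fun x => ~ P x).
Proof.
  intros [f [Hf HP]]. exists (fun x => 1 - f x).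
  split; [apply computable_sub; auto using computable_const|]. intros x. rewrite HP. lia.
Qed.

Lemma rdec_le f g : computable_fun f -> computable_fun g -> rdec (fun x => f x <= g x).
Proof.
  intros Hf Hg. exists (fun x => f x - g x).
  split; [now apply computable_sub|]. intros x. lia.
Qed.

Lemma rdec_lt f g : computable_fun f -> computable_fun g -> rdec (fun x => f x < g x).
Proof. intros Hf Hg. apply rdec_le; [now apply computable_succ|exact Hg]. Qed.

Lemma rdec_eq f g : computable_fun f -> computable_fun g -> rdec (fun x => f x = g x).
Proof.
  intros Hf Hg. apply rdec_ext with (fun x => f x <= g x /\ g x <= f x); [intros; lia|].
  apply rdec_and; apply rdec_le; assumption.
Qed.

Lemma rdec_ball (P : nat -> nat -> Prop) b :
  rdec (fun z => P (p1 z) (p2 z)) -> computable_fun b ->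
  rdec (fun x => forall k, k < b x -> P k x).
Proof.
  intros [f [Hf HP]] Hb. exists (fun x => bsum (fun k => f (npair k x)) (b x)). split.
  - apply (computable_bsum (fun k x => f (npair k x))); [|exact Hb].
    apply computable_ext with f; [|exact Hf]. intros z. now rewrite npair_p1_p2.
  - intros x. rewrite bsum_zero.
    split; intros H k Hk; specialize (H k Hk).
    + specialize (HP (npair k x)). rewrite p1_npair, p2_npair in HP. now apply HP.
    + specialize (HP (npair k x)). rewrite p1_npair, p2_npair in HP. now apply HP.
Qed.

Lemma rdec_bex (P : nat -> nat -> Prop) b :
  rdec (fun z => P (p1 z) (p2 z)) -> computable_fun b ->
  rdec (fun x => exists k, k < b x /\ P k x).
Proof.
  intros HP Hb. apply rdec_ext with (fun x => ~ forall k, k < b x -> ~ P k x).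
  - intros x. split.
    + intros H. apply NNPP. intros H'. apply H. intros k Hk HPk. apply H'. eauto.
    + intros [k [Hk HPk]] H. now apply (H k Hk).
  - apply rdec_not, rdec_ball; [now apply rdec_not|exact Hb].
Qed.

Lemma computable_min (P : nat -> nat -> Prop) :
  rdec (fun z => P (p1 z) (p2 z)) -> (forall x, exists n, P x n) ->
  exists h, computable_fun h /\ forall x, P x (h x).
Proof.
  intros [f [Hf HP]] Hex.
  assert (HP' : forall x n, P x n <-> f (npair x n) = 0).
  { intros x n. specialize (HP (npair x n)). now rewrite p1_npair, p2_npair in HP. }
  destruct (computable_least (fun n x => f (npair x n))) as [h [Hh Hz]].
  - destruct Hf as [cf Hf]. destruct computable2_npair as [cp Hp].
    exists (RComp cf [RComp cp [RProj 1; RProj 0]]). intros a b.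
    apply ev_comp with [npair b a]; [|apply Hf].
    constructor; [|constructor]. apply ev_comp with [b; a]; [|apply Hp].
    repeat constructor.
  - intros x. destruct (Hex x) as [n Hn]. exists n. now apply HP'.
  - exists h. split; [exact Hh|]. intros x. apply HP', Hz.
Qed.

(** The values are reversed against [rdec], so that [bsum] of the resulting function counts the
    arguments at which [P] holds. *)
Lemma computable_ite (P : nat -> Prop) :
  rdec P -> exists f, computable_fun f /\
    forall x, (P x -> f x = 1) /\ (~ P x -> f x = 0).
Proof.
  intros [f [Hf HP]]. exists (fun x => 1 - f x).
  split; [apply computable_sub; auto using computable_const|].
  intros x. rewrite HP. lia.
Qed.

Lemma sigma1_intro (Q : nat -> nat -> Prop) (P : nat -> Prop) :
  rdec (fun z => Q (p1 z) (p2 z)) -> (forall x, P x <-> exists t, Q x t) -> sigma1 P.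
Proof.
  intros [f [Hf HQ]] H. exists f. split; [exact Hf|]. intros x. rewrite H.
  split; intros [t Ht]; exists t; specialize (HQ (npair x t));
    rewrite p1_npair, p2_npair in HQ; now apply HQ.
Qed.

Lemma sigma1_elim (P : nat -> Prop) :
  sigma1 P -> exists Q : nat -> nat -> Prop,
    rdec (fun z => Q (p1 z) (p2 z)) /\ (forall x, P x <-> exists t, Q x t).
Proof.
  intros [f [Hf HP]]. exists (fun x t => f (npair x t) = 0). split; [|exact HP].
  exists f. split; [exact Hf|]. intros x. now rewrite npair_p1_p2.
Qed.

Lemma sigma1_ext P Q : (forall x, P x <-> Q x) -> sigma1 P -> sigma1 Q.
Proof. intros H [f [Hf HP]]. exists f. split; [exact Hf|]. intros x. now rewrite <- H. Qed.

Ltac solve_computable :=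
  repeat first
    [ assumption
    | apply computable_id | apply computable_const | apply computable_p1
    | apply computable_p2 | apply computable_npair | apply computable_succ
    | apply computable_predn | apply computable_add | apply computable_sub
    | apply computable_mul | apply computable_pow2 ].

Lemma sigma1_rdec P : rdec P -> sigma1 P.
Proof.
  intros H. apply sigma1_intro with (fun x _ => P x).
  - apply (rdec_subst P); [exact H|solve_computable].
  - intros x. split; [intros; now exists 0 | now intros [_ ?]].
Qed.

Lemma sigma1_subst P f : sigma1 P -> computable_fun f -> sigma1 (fun x => P (f x)).
Proof.
  intros HP Hf. destruct (sigma1_elim P HP) as [Q [HQ H]].
  apply sigma1_intro with (fun x t => Q (f x) t); [|intros x; apply H].
  apply (rdec_app2 Q _ _ HQ); [|solve_computable].
  apply (computable_comp f); solve_computable.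
Qed.

Lemma sigma1_app2 (P : nat -> nat -> Prop) f g :
  sigma1 (fun z => P (p1 z) (p2 z)) -> computable_fun f -> computable_fun g ->
  sigma1 (fun x => P (f x) (g x)).
Proof.
  intros HP Hf Hg.
  apply sigma1_ext with (fun x => (fun z => P (p1 z) (p2 z)) (npair (f x) (g x))).
  - intros x. cbv beta. now rewrite p1_npair, p2_npair.
  - apply (sigma1_subst _ _ HP), computable_npair; assumption.
Qed.

Lemma sigma1_ex (P : nat -> nat -> Prop) :
  sigma1 (fun z => P (p1 z) (p2 z)) -> sigma1 (fun x => exists k, P k x).
Proof.
  intros HP. destruct (sigma1_elim _ HP) as [Q [HQ H]].
  apply sigma1_intro with (fun x t => Q (npair (p1 t) x) (p2 t)).
  - apply (rdec_app2 Q _ _ HQ); solve_computable.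
  - intros x. split.
    + intros [k Hk]. specialize (H (npair k x)). rewrite p1_npair, p2_npair in H.
      destruct (proj1 H Hk) as [t Ht]. exists (npair k t).
      now rewrite p1_npair, p2_npair.
    + intros [t Ht]. exists (p1 t). specialize (H (npair (p1 t) x)).
      rewrite p1_npair, p2_npair in H. apply H. eauto.
Qed.

Lemma sigma1_and P Q : sigma1 P -> sigma1 Q -> sigma1 (fun x => P x /\ Q x).
Proof.
  intros HP HQ. destruct (sigma1_elim _ HP) as [P' [HP' EP]].
  destruct (sigma1_elim _ HQ) as [Q' [HQ' EQ]].
  apply sigma1_intro with (fun x t => P' x (p1 t) /\ Q' x (p2 t)).
  - apply rdec_and; [apply (rdec_app2 P')|apply (rdec_app2 Q')]; solve_computable.
  - intros x. rewrite EP, EQ. split.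
    + intros [[t Ht] [u Hu]]. exists (npair t u). now rewrite p1_npair, p2_npair.
    + intros [t [H1 H2]]. eauto.
Qed.

Lemma sigma1_or P Q : sigma1 P -> sigma1 Q -> sigma1 (fun x => P x \/ Q x).
Proof.
  intros HP HQ. destruct (sigma1_elim _ HP) as [P' [HP' EP]].
  destruct (sigma1_elim _ HQ) as [Q' [HQ' EQ]].
  apply sigma1_intro with (fun x t => P' x t \/ Q' x t).
  - apply rdec_or; [apply (rdec_app2 P')|apply (rdec_app2 Q')]; solve_computable.
  - intros x. rewrite EP, EQ. split; [intros [[t Ht]|[t Ht]]|intros [t [H|H]]]; eauto.
Qed.

Lemma bounded_collection (Q : nat -> nat -> Prop) b :
  (forall k, k < b -> exists t, Q k t) -> exists T, forall k, k < b -> exists t, t < T /\ Q k t.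
Proof.
  induction b as [|b IH]; intros H; [exists 0; lia|].
  destruct IH as [T HT]; [auto|]. destruct (H b) as [t Ht]; [lia|].
  exists (T + S t). intros k Hk. destruct (Nat.eq_dec k b) as [->|].
  - exists t. split; [lia|exact Ht].
  - destruct (HT k) as [u [Hu HQ]]; [lia|]. exists u. split; [lia|exact HQ].
Qed.

(** Finitely many witnesses have a common bound, so the unbounded quantifier moves in front of the
    bounded one and leaves a decidable matrix. *)
Lemma sigma1_ball (P : nat -> nat -> Prop) b :
  sigma1 (fun z => P (p1 z) (p2 z)) -> computable_fun b ->
  sigma1 (fun x => forall k, k < b x -> P k x).
Proof.
  intros HP Hb. destruct (sigma1_elim _ HP) as [Q [HQ H]].
  assert (H' : forall k x, P k x <-> exists t, Q (npair k x) t).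
  { intros k x. specialize (H (npair k x)). now rewrite p1_npair, p2_npair in H. }
  apply sigma1_intro with
    (fun x T => forall k, k < b x -> exists t, t < T /\ Q (npair k x) t).
  - apply (rdec_ball (fun k z => exists t, t < p2 z /\ Q (npair k (p1 z)) t)).
    + apply (rdec_bex (fun t z => Q (npair (p1 z) (p1 (p2 z))) t)); [|solve_computable].
      apply (rdec_app2 Q); solve_computable.
    + apply (computable_comp b); solve_computable.
  - intros x. split.
    + intros Hk. apply (bounded_collection (fun k t => Q (npair k x) t)).
      intros k Hlt. apply H'. auto.
    + intros [T HT] k Hk. destruct (HT k Hk) as [t [_ Ht]]. apply H'. eauto.
Qed.

(** The generated induction principle gives no hypothesis for the codes inside the list of an
    [RComp]. *)
Lemma rcode_nested_ind (P : rcode -> Prop) :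
  P RZero -> P RSucc -> (forall i, P (RProj i)) ->
  (forall f gs, P f -> List.Forall P gs -> P (RComp f gs)) ->
  (forall f g, P f -> P g -> P (RPrec f g)) -> (forall f, P f -> P (RMu f)) ->
  forall c, P c.
Proof.
  intros HZ HS HP HC HR HM. fix IH 1. intros [| |i|f gs|f g|f].
  - exact HZ.
  - exact HS.
  - apply HP.
  - apply HC; [apply IH|].
    induction gs as [|g gs IHgs]; constructor; [apply IH|exact IHgs].
  - apply HR; apply IH.
  - apply HM, IH.
Qed.

(** Single-valuedness is what allows [sigma1_ce] to read a halting search backwards. For [RMu], of
    two different results the larger one requires a positive value at the smaller one, where the
    value is 0. *)
Lemma reval_det c : forall v y y', reval c v y -> reval c v y' -> y = y'.
Proof.
  induction c as [| |i|f gs IHf IHgs|f g IHf IHg|f IHf] using rcode_nested_ind;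
    intros v y y' H H'.
  - inversion H; inversion H'; congruence.
  - inversion H; inversion H'; congruence.
  - inversion H; inversion H'; congruence.
  - inversion H as [| | |? ? ? ws ? HL Hf| | |]; subst.
    inversion H' as [| | |? ? ? ws' ? HL' Hf'| | |]; subst.
    assert (ws = ws') as <-; [|eauto].
    clear - IHgs HL HL'. revert ws ws' HL HL'.
    induction IHgs as [|g gs Hg _ IH]; intros ws ws' HL HL';
      inversion HL; inversion HL'; subst; [reflexivity|].
    f_equal; eauto.
  - destruct v as [|n v]; [inversion H|].
    revert y y' H H'. induction n as [|n IHn]; intros y y' H H'.
    + inversion H; inversion H'; subst; eauto.
    + inversion H; inversion H'; subst.
      match goal with
      | H1 : reval (RPrec f g) (n :: v) ?a, H2 : reval (RPrec f g) (n :: v) ?b |- _ =>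
          assert (a = b) as <- by eauto
      end. eauto.
  - inversion H as [| | | | | |? ? ? H0 Hlt]; subst.
    inversion H' as [| | | | | |? ? ? H0' Hlt']; subst.
    destruct (lt_eq_lt_dec y y') as [[Hl|He]|Hl]; [exfalso|exact He|exfalso].
    + destruct (Hlt' y Hl) as [k Hk]. specialize (IHf _ _ _ H0 Hk). discriminate.
    + destruct (Hlt y' Hl) as [k Hk]. specialize (IHf _ _ _ H0' Hk). discriminate.
Qed.

Lemma sigma1_ce P : sigma1 P -> ce_set P.
Proof.
  intros [f [[cf Hf] HP]]. destruct computable2_npair as [cp Hp].
  set (c := RComp cf [RComp cp [RProj 1; RProj 0]]).
  assert (Hc : forall t x, reval c [t; x] (f (npair x t))).
  { intros t x. apply ev_comp with [npair x t]; [|apply Hf].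
    constructor; [|constructor]. apply ev_comp with [x; t]; [|apply Hp].
    repeat constructor. }
  exists (RMu c). intros x. rewrite HP. split.
  - intros Hex. destruct (least_zero _ Hex) as [t [H0 Hlt]]. exists t. constructor.
    + rewrite <- H0. apply Hc.
    + intros m Hm. exists (pred (f (npair x m))).
      specialize (Hlt m Hm). cbv beta in Hlt.
      replace (S (pred (f (npair x m)))) with (f (npair x m)) by lia. apply Hc.
  - intros [y Hy]. exists y.
    inversion Hy as [| | | | | |? ? ? H0 _]; subst.
    exact (reval_det c _ _ _ (Hc y x) H0).
Qed.

(** * A universal c.e. set *)

(** The successor reserves 0 for the empty list. *)
Definition ncons (a l : nat) : nat := S (npair a l).
Definition nhd (w : nat) : nat := p1 (pred w).
Definition ntl (w : nat) : nat := p2 (pred w).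
Definition enc_list (l : list nat) : nat := fold_right ncons 0 l.
Definition ndrop (j w : nat) : nat := nat_rect (fun _ => nat) w (fun _ r => ntl r) j.
Definition nmem (a w : nat) : Prop := exists j, j < w /\ ndrop j w <> 0 /\ nhd (ndrop j w) = a.

Lemma nhd_ncons a l : nhd (ncons a l) = a.
Proof. apply p1_npair. Qed.

Lemma ntl_ncons a l : ntl (ncons a l) = l.
Proof. apply p2_npair. Qed.

Lemma ncons_nhd_ntl w : w <> 0 -> ncons (nhd w) (ntl w) = w.
Proof. intros H. unfold ncons, nhd, ntl. rewrite npair_p1_p2. lia. Qed.

Lemma npair_ge_r a b : b <= npair a b.
Proof. rewrite npair_triangle. lia. Qed.

Lemma nhd_nil : nhd 0 = 0.
Proof. change (nhd 0) with (p1 (npair 0 0)). apply p1_npair. Qed.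

Lemma ntl_nil : ntl 0 = 0.
Proof. change (ntl 0) with (p2 (npair 0 0)). apply p2_npair. Qed.

Lemma enc_list_cons a l : enc_list (a :: l) = ncons a (enc_list l).
Proof. reflexivity. Qed.

(** Every number codes a list, so a witness found among the numbers can always be read as a list. *)
Lemma enc_list_surj w : exists l, enc_list l = w.
Proof.
  induction w as [w IH] using (well_founded_induction lt_wf).
  destruct (Nat.eq_dec w 0) as [->|Hw]; [now exists []|].
  destruct (IH (ntl w)) as [l Hl].
  - rewrite <- (ncons_nhd_ntl w Hw) at 2. unfold ncons.
    pose proof (npair_ge_r (nhd w) (ntl w)). lia.
  - exists (nhd w :: l). simpl. rewrite Hl. now apply ncons_nhd_ntl.
Qed.

Lemma ndrop_S j w : ndrop (S j) w = ndrop j (ntl w).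
Proof.
  unfold ndrop. simpl. induction j as [|j IH]; simpl; [reflexivity|]. now rewrite IH.
Qed.

Lemma ndrop_nil j : ndrop j 0 = 0.
Proof. induction j as [|j IH]; [reflexivity|]. now rewrite ndrop_S, ntl_nil. Qed.

Lemma nth_enc_list i v : nhd (ndrop i (enc_list v)) = nth i v 0.
Proof.
  revert v. induction i as [|i IH]; intros [|a v].
  - apply nhd_nil.
  - apply nhd_ncons.
  - now rewrite ndrop_nil, nhd_nil.
  - rewrite ndrop_S. simpl enc_list. rewrite ntl_ncons. apply IH.
Qed.

Lemma length_enc_list l : length l <= enc_list l.
Proof.
  induction l as [|a l IH]; simpl; [lia|]. unfold ncons.
  pose proof (npair_ge_r a (enc_list l)). lia.
Qed.

Lemma ndrop_enc_list j l : ndrop j (enc_list l) = enc_list (skipn j l).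
Proof.
  revert l. induction j as [|j IH]; intros [|a l]; try reflexivity.
  - apply ndrop_nil.
  - rewrite ndrop_S. simpl. rewrite ntl_ncons. apply IH.
Qed.

Lemma nmem_enc_list a l : nmem a (enc_list l) <-> In a l.
Proof.
  unfold nmem. split.
  - intros [j [_ [H0 H]]]. rewrite ndrop_enc_list in H0, H.
    rewrite <- (firstn_skipn j l). apply in_or_app. right.
    destruct (skipn j l) as [|b l'] eqn:E; [now elim H0|].
    left. simpl in H. now rewrite nhd_ncons in H.
  - intros H. apply in_split in H as [l1 [l2 ->]]. exists (length l1).
    rewrite ndrop_enc_list, skipn_app, skipn_all, Nat.sub_diag. simpl.
    repeat split; [|discriminate|apply nhd_ncons].
    apply Nat.lt_le_trans with (length (l1 ++ a :: l2)); [|apply length_enc_list].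
    rewrite length_app. simpl. lia.
Qed.

(** * Evaluation as existence of a finite list of justified facts *)

Fixpoint code_rcode (c : rcode) : nat :=
  match c with
  | RZero => npair 0 0
  | RSucc => npair 1 0
  | RProj i => npair 2 i
  | RComp f gs => npair 3 (npair (code_rcode f) (enc_list (map code_rcode gs)))
  | RPrec f g => npair 4 (npair (code_rcode f) (code_rcode g))
  | RMu f => npair 5 (code_rcode f)
  end.

(* [fact 0 c v y] stands for [reval c v y] and [fact 1 gs v ys] for [revalL gs v ys];
   [justified F w] says that [F] is the conclusion of an evaluation rule whose
   premises all belong to the list [w]. *)
Definition fact (kind c v y : nat) : nat := npair (npair kind c) (npair v y).

(** The guard [v <> 0] keeps the recursion clauses away from the empty vector, on which [RPrec] does
    not evaluate although [nhd 0 = 0]. For [RSucc] and [RProj] this default agrees with the default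
    of [nth]. *)
Definition justified_eval (c v y w : nat) : Prop :=
  (p1 c = 0 /\ y = 0) \/
  (p1 c = 1 /\ y = S (nhd v)) \/
  (p1 c = 2 /\ y = nhd (ndrop (p2 c) v)) \/
  (p1 c = 3 /\ exists ws,
     nmem (fact 1 (p2 (p2 c)) v ws) w /\ nmem (fact 0 (p1 (p2 c)) ws y) w) \/
  (p1 c = 4 /\ v <> 0 /\ nhd v = 0 /\ nmem (fact 0 (p1 (p2 c)) (ntl v) y) w) \/
  (p1 c = 4 /\ v <> 0 /\ nhd v <> 0 /\ exists z,
     nmem (fact 0 c (ncons (pred (nhd v)) (ntl v)) z) w /\
     nmem (fact 0 (p2 (p2 c)) (ncons (pred (nhd v)) (ncons z (ntl v))) y) w) \/
  (p1 c = 5 /\ nmem (fact 0 (p2 c) (ncons y v) 0) w /\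
   forall m, m < y -> exists k, nmem (fact 0 (p2 c) (ncons m v) (S k)) w).

Definition justified_evalL (gs v ys w : nat) : Prop :=
  (gs = 0 /\ ys = 0) \/
  (gs <> 0 /\ ys <> 0 /\
   nmem (fact 0 (nhd gs) v (nhd ys)) w /\ nmem (fact 1 (ntl gs) v (ntl ys)) w).

Definition justified (F w : nat) : Prop :=
  (p1 (p1 F) = 0 /\ justified_eval (p2 (p1 F)) (p1 (p2 F)) (p2 (p2 F)) w) \/
  (p1 (p1 F) = 1 /\ justified_evalL (p2 (p1 F)) (p1 (p2 F)) (p2 (p2 F)) w).

Lemma justified_fact0 c v y w : justified (fact 0 c v y) w <-> justified_eval c v y w.
Proof.
  unfold justified, fact. repeat rewrite ?p1_npair, ?p2_npair.
  intuition discriminate.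
Qed.

Lemma justified_fact1 c v y w : justified (fact 1 c v y) w <-> justified_evalL c v y w.
Proof.
  unfold justified, fact. repeat rewrite ?p1_npair, ?p2_npair.
  intuition discriminate.
Qed.

(** Entries are justified by those that come after them, so the list is a proof in reverse order.
    The bound [j < w] reaches every entry because a list is no longer than its code, and past the
    end [ndrop] returns 0. *)
Definition derivation (w : nat) : Prop :=
  forall j, j < w -> ndrop j w = 0 \/ justified (nhd (ndrop j w)) (ntl (ndrop j w)).

Lemma derivation_cons F l :
  derivation (enc_list (F :: l)) <-> justified F (enc_list l) /\ derivation (enc_list l).
Proof.
  unfold derivation. split.
  - intros H. split.
    + destruct (H 0) as [H0|H0]; [simpl; unfold ncons; lia|discriminate|].
      simpl in H0. now rewrite nhd_ncons, ntl_ncons in H0.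
    + intros j Hj. specialize (H (S j)). rewrite ndrop_S in H. simpl in H.
      rewrite ntl_ncons in H. apply H. unfold ncons.
      pose proof (npair_ge_r F (enc_list l)). lia.
  - intros [HF H] [|j] _; simpl enc_list.
    + right. simpl. now rewrite nhd_ncons, ntl_ncons.
    + rewrite ndrop_S, ntl_ncons.
      destruct (le_lt_dec (enc_list l) j) as [Hj|Hj]; [left|now apply H].
      rewrite ndrop_enc_list, skipn_all2; [reflexivity|].
      pose proof (length_enc_list l). lia.
Qed.

Lemma justified_incl F l l' :
  incl l l' -> justified F (enc_list l) -> justified F (enc_list l').
Proof.
  intros Hi.
  assert (Hm : forall a, nmem a (enc_list l) -> nmem a (enc_list l')).
  { intros a. rewrite !nmem_enc_list. apply Hi. }
  unfold justified, justified_eval, justified_evalL.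
  intros [[Hk H]|[Hk H]]; [left|right]; (split; [exact Hk|]).
  - destruct H as [H|[H|[H|[[? [ws [? ?]]]|[H|[[? [? [? [z [? ?]]]]]|[? [? H]]]]]]]]; eauto 10.
    + right; right; right; right; left. intuition.
    + do 5 right; left. repeat split; eauto.
    + do 6 right. repeat split; auto. intros m Hlt. destruct (H m Hlt) as [k Hk']. eauto.
  - intuition.
Qed.

Lemma derivation_app l l' :
  derivation (enc_list l) -> derivation (enc_list l') -> derivation (enc_list (l ++ l')).
Proof.
  intros H H'. induction l as [|F l IH]; [exact H'|].
  apply derivation_cons in H as [HF H]. simpl app. apply derivation_cons.
  split; [|now apply IH]. apply justified_incl with l; [apply incl_appl, incl_refl|exact HF].
Qed.

Definition derivable (F : nat) : Prop := exists l, derivation (enc_list l) /\ In F l.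

(** A list may contain facts about numbers that code no program; these count as true vacuously. No
    harm is done, since a rule applied to a genuine code refers back only to genuine codes. *)
Definition true_fact (F : nat) : Prop :=
  (forall c v y, F = fact 0 (code_rcode c) (enc_list v) y -> reval c v y) /\
  (forall gs v ys, F = fact 1 (enc_list (map code_rcode gs)) (enc_list v) (enc_list ys) ->
     revalL gs v ys).

Lemma enc_list_nil l : enc_list l = 0 -> l = [].
Proof. destruct l; [auto|discriminate]. Qed.

Lemma justified_true F l :
  (forall F', In F' l -> true_fact F') -> justified F (enc_list l) -> true_fact F.
Proof.
  intros Hl.
  assert (H0 : forall c v y, nmem (fact 0 (code_rcode c) (enc_list v) y) (enc_list l) ->
                 reval c v y).
  { intros c v y H. apply nmem_enc_list, Hl in H. now apply H. }
  assert (H1 : forall gs v ys,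
      nmem (fact 1 (enc_list (map code_rcode gs)) (enc_list v) (enc_list ys)) (enc_list l) ->
      revalL gs v ys).
  { intros gs v ys H. apply nmem_enc_list, Hl in H. now apply H. }
  intros HJ. split.
  - intros c v y ->. apply justified_fact0 in HJ. unfold justified_eval in HJ.
    destruct c as [| |i|f gs|f g|f]; simpl code_rcode in HJ;
      rewrite !p1_npair, ?p2_npair, ?p1_npair, ?p2_npair in HJ;
      destruct HJ as [H|[H|[H|[H|[H|[H|H]]]]]]; destruct H as [E H]; try discriminate E.
    + subst. constructor.
    + subst y. pose proof (nth_enc_list 0 v) as Hn. simpl in Hn. rewrite Hn. constructor.
    + subst y. rewrite nth_enc_list. constructor.
    + destruct H as [ws [Ha Hb]]. destruct (enc_list_surj ws) as [ws' <-].
      apply ev_comp with ws'; auto.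
    + destruct H as [Hv [Hn H]]. destruct v as [|n v]; [now elim Hv|].
      simpl enc_list in *. rewrite nhd_ncons in Hn. rewrite ntl_ncons in H.
      subst n. constructor. auto.
    + destruct H as [Hv [Hn [z [Ha Hb]]]]. destruct v as [|n v]; [now elim Hv|].
      simpl enc_list in *. rewrite nhd_ncons in *. rewrite ntl_ncons in *.
      destruct n as [|n]; [easy|]. simpl pred in *.
      apply ev_precS with z; [apply (H0 (RPrec f g) (n :: v)) | apply (H0 g (n :: z :: v))];
        assumption.
    + destruct H as [Ha Hb]. constructor; [apply (H0 f (y :: v)); assumption|].
      intros m Hm. destruct (Hb m Hm) as [k Hk]. exists k. now apply (H0 f (m :: v)).
  - intros gs v ys ->. apply justified_fact1 in HJ. unfold justified_evalL in HJ.
    destruct HJ as [[Hg Hy]|[Hg [Hy [Ha Hb]]]].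
    + apply enc_list_nil in Hy as ->. apply enc_list_nil in Hg.
      destruct gs; [constructor|discriminate].
    + destruct gs as [|g gs]; [now elim Hg|]. destruct ys as [|y ys]; [now elim Hy|].
      simpl in Ha, Hb. rewrite !nhd_ncons in Ha. rewrite !ntl_ncons in Hb.
      constructor; auto.
Qed.

Lemma derivable_true F : derivable F -> true_fact F.
Proof.
  intros [l [Hd Hin]]. revert F Hin.
  induction l as [|F l IH]; intros F' Hin; [easy|].
  apply derivation_cons in Hd as [HJ Hd]. specialize (IH Hd).
  destruct Hin as [<-|Hin]; [|auto]. now apply justified_true with l.
Qed.

Lemma derivable_step F l :
  (forall F', In F' l -> derivable F') -> justified F (enc_list l) -> derivable F.
Proof.
  intros Hl HJ.
  assert (H : exists l', derivation (enc_list l') /\ incl l l').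
  { clear HJ. induction l as [|a l IH].
    - exists []. split; [intros j Hj; simpl in Hj; lia | apply incl_refl].
    - destruct IH as [l' [Hd Hi]]; [intros; apply Hl; now right|].
      destruct (Hl a) as [l'' [Hd' Ha]]; [now left|].
      exists (l'' ++ l'). split; [now apply derivation_app|].
      intros x [<-|Hx]; apply in_or_app; auto. }
  destruct H as [l' [Hd Hi]]. exists (F :: l'). split; [|now left].
  apply derivation_cons. split; [|exact Hd]. now apply justified_incl with l.
Qed.

Lemma reval_derivable c :
  forall v y, reval c v y -> derivable (fact 0 (code_rcode c) (enc_list v) y).
Proof.
  assert (HL : forall gs v ws,
    List.Forall (fun g => forall v y, reval g v y ->
                   derivable (fact 0 (code_rcode g) (enc_list v) y)) gs ->
    revalL gs v ws ->
    derivable (fact 1 (enc_list (map code_rcode gs)) (enc_list v) (enc_list ws))).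
  { intros gs v ws Hgs. revert ws.
    induction Hgs as [|g gs Hg _ IH]; intros ws H; inversion H; subst.
    - apply derivable_step with []; [easy|]. apply justified_fact1. now left.
    - match goal with H1 : reval g v ?a, H2 : revalL gs v ?b |- _ =>
        apply derivable_step with [fact 0 (code_rcode g) (enc_list v) a;
          fact 1 (enc_list (map code_rcode gs)) (enc_list v) (enc_list b)] end.
      + intros F [<-|[<-|[]]]; auto.
      + apply justified_fact1. right. rewrite !nmem_enc_list. simpl map.
        rewrite !enc_list_cons, !nhd_ncons, !ntl_ncons.
        repeat split; [discriminate|discriminate|now left|right; now left]. }
  induction c as [| |i|f gs IHf IHgs|f g IHf IHg|f IHf] using rcode_nested_ind;
    intros v y H.
  - inversion H; subst. apply derivable_step with []; [easy|]. apply justified_fact0.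
    left. simpl. now rewrite p1_npair.
  - inversion H; subst. apply derivable_step with []; [easy|]. apply justified_fact0.
    right. left. simpl. rewrite p1_npair. split; [reflexivity|].
    now rewrite <- (nth_enc_list 0 v).
  - inversion H; subst. apply derivable_step with []; [easy|]. apply justified_fact0.
    right. right. left. simpl. rewrite p1_npair, p2_npair. split; [reflexivity|].
    now rewrite nth_enc_list.
  - inversion H as [| | |? ? ? ws ? HLs Hf| | |]; subst.
    apply derivable_step with
      [fact 1 (enc_list (map code_rcode gs)) (enc_list v) (enc_list ws);
       fact 0 (code_rcode f) (enc_list ws) y].
    + intros F [<-|[<-|[]]]; auto.
    + apply justified_fact0. right. right. right. left. simpl code_rcode.
      rewrite !p1_npair, !p2_npair, !p1_npair, ?p2_npair. split; [reflexivity|].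
      exists (enc_list ws). rewrite !nmem_enc_list. split; [now left|right; now left].
  - destruct v as [|n v]; [inversion H|].
    revert y H. induction n as [|n IHn]; intros y H; inversion H; subst.
    + apply derivable_step with [fact 0 (code_rcode f) (enc_list v) y].
      * intros F [<-|[]]. auto.
      * apply justified_fact0. do 4 right. left. rewrite nmem_enc_list. simpl code_rcode.
        rewrite enc_list_cons, !nhd_ncons, !ntl_ncons.
        repeat rewrite ?p1_npair, ?p2_npair.
        repeat split; [discriminate|now left].
    + match goal with H1 : reval (RPrec f g) (n :: v) ?z |- _ =>
        apply derivable_step with
          [fact 0 (code_rcode (RPrec f g)) (enc_list (n :: v)) z;
           fact 0 (code_rcode g) (enc_list (n :: z :: v)) y]; [|
        apply justified_fact0; do 5 right; left; rewrite (enc_list_cons (S n)), nhd_ncons, ntl_ncons;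
        split; [apply p1_npair|]; split; [discriminate|]; split; [discriminate|]; exists z ] end.
      * intros F [<-|[<-|[]]]; auto.
      * rewrite !nmem_enc_list. simpl pred.
        split; [now left|right; left].
        simpl code_rcode. repeat rewrite p2_npair. reflexivity.
  - inversion H as [| | | | | |? ? ? Hz Hlt]; subst.
    (* All values below [y] are chosen at once so that they can be listed as premises; from [y] on
       the choice is arbitrary. *)
    destruct (choice (fun m k => m < y -> reval f (m :: v) (S k))) as [h Hh].
    { intros m. destruct (le_lt_dec y m) as [Hm|Hm]; [exists 0; lia|].
      destruct (Hlt m Hm) as [k Hk]. now exists k. }
    apply derivable_step with
      (fact 0 (code_rcode f) (enc_list (y :: v)) 0 ::
       map (fun m => fact 0 (code_rcode f) (enc_list (m :: v)) (S (h m))) (seq 0 y)).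
    + intros F [<-|HF]; [auto|]. apply in_map_iff in HF as [m [<- Hm]].
      apply in_seq in Hm. apply IHf, Hh. lia.
    + apply justified_fact0. do 6 right. simpl code_rcode. rewrite p1_npair, p2_npair.
      split; [reflexivity|]. rewrite nmem_enc_list. split; [now left|].
      intros m Hm. exists (h m). apply nmem_enc_list. right.
      apply in_map_iff. exists m. split; [reflexivity|]. apply in_seq. lia.
Qed.

Definition universal (e x : nat) : Prop :=
  exists y w, derivation w /\ nmem (fact 0 e (ncons x 0) y) w.

Lemma universal_rcode c x : universal (code_rcode c) x <-> exists y, reval c [x] y.
Proof.
  split.
  - intros [y [w [Hd Hm]]]. exists y. destruct (enc_list_surj w) as [l <-].
    apply nmem_enc_list in Hm.
    apply (derivable_true (fact 0 (code_rcode c) (enc_list [x]) y)); [|reflexivity].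
    now exists l.
  - intros [y Hy]. destruct (reval_derivable c [x] y Hy) as [l [Hd Hl]].
    exists y, (enc_list l). split; [exact Hd|]. now apply nmem_enc_list.
Qed.

Lemma universal_ce (P : nat -> Prop) : ce_set P -> exists e, forall x, P x <-> universal e x.
Proof.
  intros [c Hc]. exists (code_rcode c). intros x. now rewrite universal_rcode.
Qed.

Lemma computable_nhd f : computable_fun f -> computable_fun (fun x => nhd (f x)).
Proof. intros Hf. unfold nhd. solve_computable. Qed.

Lemma computable_ntl f : computable_fun f -> computable_fun (fun x => ntl (f x)).
Proof. intros Hf. unfold ntl. solve_computable. Qed.

Lemma computable_ncons f g :
  computable_fun f -> computable_fun g -> computable_fun (fun x => ncons (f x) (g x)).
Proof. intros Hf Hg. unfold ncons. solve_computable. Qed.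

Lemma computable_ndrop f g :
  computable_fun f -> computable_fun g -> computable_fun (fun x => ndrop (f x) (g x)).
Proof.
  intros Hf Hg. unfold ndrop.
  apply (computable_rec g f (fun _ _ r => ntl r)); auto.
  apply computable_ntl. solve_computable.
Qed.

Lemma computable_fact k c v y :
  computable_fun k -> computable_fun c -> computable_fun v -> computable_fun y ->
  computable_fun (fun x => fact (k x) (c x) (v x) (y x)).
Proof. intros. unfold fact. solve_computable. Qed.

Ltac solve_computable_list :=
  repeat first
    [ assumption
    | apply computable_nhd | apply computable_ntl | apply computable_ncons
    | apply computable_ndrop | apply computable_fact | progress solve_computable ].

Lemma rdec_nmem f g :
  computable_fun f -> computable_fun g -> rdec (fun x => nmem (f x) (g x)).
Proof.
  intros Hf Hg. apply (rdec_app2 nmem); auto. unfold nmem.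
  apply (rdec_bex (fun j z => ndrop j (p2 z) <> 0 /\ nhd (ndrop j (p2 z)) = p1 z));
    [|solve_computable].
  apply rdec_and; [apply rdec_not|]; apply rdec_eq; solve_computable_list.
Qed.

Ltac solve_sigma1 :=
  repeat first
    [ apply sigma1_and | apply sigma1_or
    | apply sigma1_rdec;
      first [ apply rdec_nmem | apply rdec_eq | apply rdec_not, rdec_eq
            | apply rdec_lt | apply rdec_le ];
      solve_computable_list ].

Lemma sigma1_derivation : sigma1 derivation.
Proof.
  unfold derivation.
  apply (sigma1_ball (fun j w => ndrop j w = 0 \/ justified (nhd (ndrop j w)) (ntl (ndrop j w))));
    [|solve_computable].
  apply sigma1_or; [solve_sigma1|].
  apply (sigma1_app2 justified); [|solve_computable_list..].
  unfold justified, justified_eval, justified_evalL. solve_sigma1.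
  - apply (sigma1_ex (fun ws z =>
      nmem (fact 1 (p2 (p2 (p2 (p1 (p1 z))))) (p1 (p2 (p1 z))) ws) (p2 z) /\
      nmem (fact 0 (p1 (p2 (p2 (p1 (p1 z))))) ws (p2 (p2 (p1 z)))) (p2 z))).
    solve_sigma1.
  - apply (sigma1_ex (fun u z =>
      nmem (fact 0 (p2 (p1 (p1 z)))
              (ncons (pred (nhd (p1 (p2 (p1 z))))) (ntl (p1 (p2 (p1 z))))) u) (p2 z) /\
      nmem (fact 0 (p2 (p2 (p2 (p1 (p1 z)))))
              (ncons (pred (nhd (p1 (p2 (p1 z))))) (ncons u (ntl (p1 (p2 (p1 z))))))
              (p2 (p2 (p1 z)))) (p2 z))).
    solve_sigma1.
  - apply (sigma1_ball (fun m z => exists k,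
      nmem (fact 0 (p2 (p2 (p1 (p1 z)))) (ncons m (p1 (p2 (p1 z)))) (S k)) (p2 z)));
      [|solve_computable].
    apply (sigma1_ex (fun k u =>
      nmem (fact 0 (p2 (p2 (p1 (p1 (p2 u))))) (ncons (p1 u) (p1 (p2 (p1 (p2 u))))) (S k))
        (p2 (p2 u)))).
    solve_sigma1.
Qed.

Lemma sigma1_universal : sigma1 (fun z => universal (p1 z) (p2 z)).
Proof.
  unfold universal.
  apply (sigma1_ex (fun y z => exists w,
    derivation w /\ nmem (fact 0 (p1 z) (ncons (p2 z) 0) y) w)).
  apply (sigma1_ex (fun w u =>
    derivation w /\ nmem (fact 0 (p1 (p2 u)) (ncons (p2 (p2 u)) 0) (p1 u)) w)).
  apply sigma1_and; [|solve_sigma1].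
  apply (sigma1_subst derivation); [apply sigma1_derivation|solve_computable].
Qed.

(** This is the normal form theorem: it replaces the inductive relation [reval] by a search through
    a decidable relation, to which the closure properties apply. *)
Lemma ce_sigma1 P : ce_set P -> sigma1 P.
Proof.
  intros H. destruct (universal_ce P H) as [e He].
  apply sigma1_ext with (fun x => universal e x); [intros x; now rewrite He|].
  apply (sigma1_app2 universal); [apply sigma1_universal|solve_computable..].
Qed.

(** * Binary strings and compactness *)

(** This is [code_str s + 1], without the truncated subtraction. Appending a bit is affine for it,
    and the strings of length [n] fill exactly the interval from [2 ^ n] to [2 ^ (n + 1) - 1]. *)
Definition num (s : str) : nat :=
  fold_left (fun acc (b : bool) => 2 * acc + (if b then 1 else 0)) s 1.

Lemma num_app_bit s b : num (s ++ [b]) = 2 * num s + (if b then 1 else 0).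
Proof. unfold num. now rewrite fold_left_app. Qed.

Lemma num_bounds s : 2 ^ length s <= num s < 2 ^ S (length s).
Proof.
  induction s as [|b s IH] using rev_ind; [simpl; unfold num; simpl; lia|].
  rewrite num_app_bit, length_app, Nat.add_1_r. simpl in *. destruct b; lia.
Qed.

Lemma num_code s : num s = S (code_str s).
Proof.
  unfold code_str. fold (num s).
  pose proof (num_bounds s). pose proof (Nat.pow_nonzero 2 (length s)). lia.
Qed.

Lemma num_inj s t : num s = num t -> s = t.
Proof.
  revert t. induction s as [|b s IH] using rev_ind; intros t; destruct t as [|c t _] using rev_ind.
  - reflexivity.
  - rewrite num_app_bit. pose proof (num_code t). unfold num at 1. simpl. destruct c; lia.
  - rewrite num_app_bit. pose proof (num_code s). unfold num at 2. simpl. destruct b; lia.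
  - rewrite !num_app_bit. intros H.
    assert (b = c) as -> by (destruct b, c; auto; lia).
    f_equal. apply IH. destruct c; lia.
Qed.

Lemma code_str_inj s t : code_str s = code_str t -> s = t.
Proof. intros H. apply num_inj. now rewrite !num_code, H. Qed.

Lemma num_surj n : 0 < n -> exists s, num s = n.
Proof.
  induction n as [n IH] using (well_founded_induction lt_wf). intros Hn.
  destruct (Nat.eq_dec n 1) as [->|H1]; [now exists []|].
  pose proof (Nat.div_mod n 2 ltac:(lia)) as E.
  pose proof (Nat.mod_upper_bound n 2 ltac:(lia)).
  destruct (IH (n / 2)) as [s Hs]; [lia|lia|].
  exists (s ++ [Nat.eqb (n mod 2) 1]). rewrite num_app_bit, Hs.
  destruct (Nat.eqb_spec (n mod 2) 1); lia.
Qed.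

Definition decode_str (n : nat) : str := epsilon (inhabits []) (fun s => code_str s = n).

Lemma code_decode n : code_str (decode_str n) = n.
Proof.
  unfold decode_str. apply epsilon_spec.
  destruct (num_surj (S n)) as [s Hs]; [lia|]. exists s. rewrite num_code in Hs. lia.
Qed.

Lemma decode_code s : decode_str (code_str s) = s.
Proof. apply code_str_inj, code_decode. Qed.

Lemma length_le_code s : length s <= code_str s.
Proof.
  pose proof (num_bounds s). rewrite num_code in H.
  pose proof (Nat.pow_gt_lin_r 2 (length s)). lia.
Qed.

Lemma num_app s r : exists k, k < 2 ^ length r /\ num (s ++ r) = num s * 2 ^ length r + k.
Proof.
  induction r as [|b r [k [Hk E]]] using rev_ind.
  - exists 0. rewrite app_nil_r. simpl. lia.
  - exists (2 * k + if b then 1 else 0).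
    rewrite app_assoc, num_app_bit, E, length_app, Nat.add_1_r. simpl.
    split; [destruct b; lia|destruct b; ring].
Qed.

Lemma num_extend s j k : k < 2 ^ j ->
  exists r, length r = j /\ num (s ++ r) = num s * 2 ^ j + k.
Proof.
  revert k. induction j as [|j IH]; intros k Hk.
  - exists []. rewrite app_nil_r. simpl in *. split; [reflexivity|lia].
  - pose proof (Nat.div_mod k 2 ltac:(lia)) as E.
    pose proof (Nat.mod_upper_bound k 2 ltac:(lia)). simpl in Hk.
    destruct (IH (k / 2)) as [r [Hr Hn]]; [lia|].
    exists (r ++ [Nat.eqb (k mod 2) 1]). split; [rewrite length_app; simpl; lia|].
    rewrite app_assoc, num_app_bit, Hn.
    replace (num s * 2 ^ S j) with (2 * (num s * 2 ^ j)) by (simpl; ring).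
    destruct (Nat.eqb_spec (k mod 2) 1); lia.
Qed.

(** Appending [j] bits multiplies [num] by [2 ^ j] and adds a remainder below [2 ^ j]. The bound on
    [j] makes the relation decidable and excludes nothing, because the code of a string is at least
    its length. *)
Definition nprefix (a b : nat) : Prop :=
  exists j, j < S b /\ exists k, k < 2 ^ j /\ S b = S a * 2 ^ j + k.

Lemma nprefix_code s t : nprefix (code_str s) (code_str t) <-> spre s t.
Proof.
  unfold nprefix. rewrite <- !num_code. split.
  - intros [j [_ [k [Hk E]]]]. destruct (num_extend s j k Hk) as [r [_ Hr]].
    exists r. apply num_inj. congruence.
  - intros [r ->]. destruct (num_app s r) as [k [Hk E]]. exists (length r).
    split; [|now exists k].
    rewrite num_code. pose proof (length_le_code (s ++ r)). rewrite length_app in H. lia.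
Qed.

Lemma rdec_nprefix f g :
  computable_fun f -> computable_fun g -> rdec (fun x => nprefix (f x) (g x)).
Proof.
  intros Hf Hg. apply (rdec_app2 nprefix); auto. unfold nprefix.
  apply (rdec_bex (fun j z => exists k, k < 2 ^ j /\ S (p2 z) = S (p1 z) * 2 ^ j + k));
    [|solve_computable].
  apply (rdec_bex (fun k u => S (p2 (p2 u)) = S (p1 (p2 u)) * 2 ^ (p1 u) + k));
    [|solve_computable].
  apply rdec_eq; solve_computable.
Qed.

Lemma spre_trans s t u : spre s t -> spre t u -> spre s u.
Proof. intros [r ->] [q ->]. exists (r ++ q). now rewrite app_assoc. Qed.

Lemma spre_length s t : spre s t -> length s <= length t.
Proof. intros [r ->]. rewrite length_app. lia. Qed.

Definition take (X : cantor) (k : nat) : str := map X (seq 0 k).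

Lemma length_take X k : length (take X k) = k.
Proof. unfold take. now rewrite length_map, length_seq. Qed.

Lemma nth_take X k i d : i < k -> nth i (take X k) d = X i.
Proof.
  intros H. unfold take.
  rewrite (nth_indep _ d (X 0)) by now rewrite length_map, length_seq.
  rewrite map_nth, seq_nth; auto.
Qed.

Lemma pre_take X k : pre (take X k) X.
Proof. intros i Hi. rewrite length_take in Hi. now rewrite nth_take. Qed.

Lemma pre_eq_take s X : pre s X -> s = take X (length s).
Proof.
  intros H. apply nth_ext with false false; [now rewrite length_take|].
  intros i Hi. rewrite nth_take by exact Hi. now rewrite H.
Qed.

Lemma take_S X k : take X (S k) = take X k ++ [X k].
Proof. unfold take. now rewrite seq_S, map_app. Qed.

Lemma take_add X k j : spre (take X k) (take X (k + j)).
Proof. unfold take. rewrite seq_app, map_app. eexists. reflexivity. Qed.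

Lemma take_le X k j : k <= j -> spre (take X k) (take X j).
Proof. intros H. replace j with (k + (j - k)) by lia. apply take_add. Qed.

Lemma pre_spre s t X : spre s t -> pre t X -> pre s X.
Proof.
  intros [r ->] H i Hi. rewrite H by (rewrite length_app; lia). now rewrite app_nth1.
Qed.

Lemma pre_pre_spre s t X : pre s X -> pre t X -> length s <= length t -> spre s t.
Proof.
  intros Hs Ht Hl. rewrite (pre_eq_take s X Hs), (pre_eq_take t X Ht). now apply take_le.
Qed.

Lemma spre_take s X k : pre s X -> length s <= k -> spre s (take X k).
Proof.
  intros H Hk. apply pre_pre_spre with X; [exact H|apply pre_take|now rewrite length_take].
Qed.

Definition upward (P : str -> Prop) : Prop := forall s b, P s -> P (s ++ [b]).

Lemma upward_app P : upward P -> forall r s, P s -> P (s ++ r).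
Proof.
  intros HP. induction r as [|b r IH]; intros s Hs; [now rewrite app_nil_r|].
  change (b :: r) with ([b] ++ r). rewrite app_assoc. apply IH, HP, Hs.
Qed.

(** König's lemma for a property that grows both along strings and with the stage [n], which allows
    one number to serve as stage and as depth. If every depth fails, the bad strings form an
    infinite tree, whose path contradicts the last hypothesis. *)
Lemma heine_borel (Q : nat -> str -> Prop) :
  (forall n, upward (Q n)) -> (forall n s, Q n s -> Q (S n) s) ->
  (forall X, exists n k, Q n (take X k)) ->
  exists n, forall s, length s = n -> Q n s.
Proof.
  intros Hup Hmon HX.
  assert (Hle : forall n m s, n <= m -> Q n s -> Q m s) by (induction 1; auto).
  set (bad := fun s => forall n, exists r, length r = n /\ ~ Q n (s ++ r)).
  destruct (classic (bad [])) as [Hbad|Hbad].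
  2:{ apply not_all_ex_not in Hbad as [n Hn]. exists n. intros s Hs.
      apply NNPP. intros H. apply Hn. now exists s. }
  exfalso.
  assert (Hstep : forall s, exists b, bad s -> bad (s ++ [b])).
  { intros s. apply NNPP. intros Hno.
    assert (Hb : forall b, bad s /\ ~ bad (s ++ [b])).
    { intros b. apply not_ex_all_not with (n := b) in Hno. tauto. }
    assert (Hc : forall b, exists n, forall r, length r = n -> Q n ((s ++ [b]) ++ r)).
    { intros b. destruct (Hb b) as [_ H]. apply not_all_ex_not in H as [n Hn].
      exists n. intros r Hr. apply NNPP. intros H'. apply Hn. now exists r. }
    destruct (Hc false) as [n0 H0]. destruct (Hc true) as [n1 H1].
    (* One bit selects the child, and [n0 + n1] dominates the depths that work for the two
       children. *)
    destruct (proj1 (Hb true) (S (n0 + n1))) as [r [Hr Hn]].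
    destruct r as [|b r]; [discriminate|]. injection Hr as Hr. apply Hn.
    change (b :: r) with ([b] ++ r). rewrite app_assoc.
    destruct b.
    - rewrite <- (firstn_skipn n1 r), app_assoc. apply upward_app; [apply Hup|].
      apply Hle with n1; [lia|]. apply H1. rewrite length_firstn. lia.
    - rewrite <- (firstn_skipn n0 r), app_assoc. apply upward_app; [apply Hup|].
      apply Hle with n0; [lia|]. apply H0. rewrite length_firstn. lia. }
  apply choice in Hstep as [next Hnext].
  set (path := fix path k := match k with 0 => [] | S k => path k ++ [next (path k)] end).
  set (X := fun k => next (path k)).
  assert (Hpath : forall k, path k = take X k).
  { induction k as [|k IH]; [reflexivity|]. rewrite take_S, <- IH. reflexivity. }
  assert (Hbadp : forall k, bad (path k)).
  { induction k as [|k IH]; [exact Hbad|]. apply Hnext, IH. }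
  destruct (HX X) as [n [k H]].
  destruct (Hbadp k n) as [r [_ Hr]]. apply Hr. rewrite Hpath.
  now apply upward_app.
Qed.

Open Scope R_scope.

(** * Lebesgue measure of open sets *)

Definition ind (P : Prop) : R := if excluded_middle_informative P then 1 else 0.

Lemma ind_true (P : Prop) : P -> ind P = 1.
Proof. unfold ind. destruct (excluded_middle_informative P); tauto. Qed.

Lemma ind_false (P : Prop) : ~ P -> ind P = 0.
Proof. unfold ind. destruct (excluded_middle_informative P); tauto. Qed.

Lemma ind_bounds P : 0 <= ind P <= 1.
Proof. unfold ind. destruct (excluded_middle_informative P); lra. Qed.

Lemma ind_le (P Q : Prop) : (P -> Q) -> ind P <= ind Q.
Proof.
  intros H. destruct (classic P) as [HP|HP].
  - rewrite !ind_true; auto. lra.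
  - rewrite (ind_false P HP). apply ind_bounds.
Qed.

(** The proportion of the [2 ^ n] extensions of [s] by [n] bits that satisfy [P]. Below, the measure
    of an open set [A] is handled as the supremum of the densities of [inside A] at the root. *)
Fixpoint density (P : str -> Prop) (s : str) (n : nat) : R :=
  match n with
  | O => ind (P s)
  | S n => (density P (s ++ [false]) n + density P (s ++ [true]) n) / 2
  end.

Lemma density_ge0 P s n : 0 <= density P s n.
Proof.
  revert s. induction n as [|n IH]; intros s; simpl; [apply ind_bounds|].
  pose proof (IH (s ++ [false])). pose proof (IH (s ++ [true])). lra.
Qed.

Lemma density_le P Q s n :
  (forall r, length r = n -> P (s ++ r) -> Q (s ++ r)) -> density P s n <= density Q s n.
Proof.
  revert s. induction n as [|n IH]; intros s H; simpl.
  - apply ind_le. specialize (H []). rewrite app_nil_r in H. auto.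
  - assert (Hb : forall b, density P (s ++ [b]) n <= density Q (s ++ [b]) n).
    { intros b. apply IH. intros r Hr. rewrite <- app_assoc. apply H. simpl. now rewrite Hr. }
    pose proof (Hb false). pose proof (Hb true). lra.
Qed.

Lemma density_or P Q s n :
  density (fun t => P t \/ Q t) s n <= density P s n + density Q s n.
Proof.
  revert s. induction n as [|n IH]; intros s; simpl.
  - destruct (classic (P s)) as [H|H]; [|destruct (classic (Q s)) as [H'|H']].
    + rewrite !ind_true by tauto. pose proof (ind_bounds (Q s)). lra.
    + rewrite (ind_true (_ \/ _)), (ind_true (Q s)) by tauto.
      pose proof (ind_bounds (P s)). lra.
    + rewrite !ind_false by tauto. lra.
  - pose proof (IH (s ++ [false])). pose proof (IH (s ++ [true])). lra.
Qed.

Lemma density_disjoint P Q s n :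
  (forall t, P t -> Q t -> False) ->
  density P s n + density Q s n <= density (fun t => P t \/ Q t) s n.
Proof.
  intros HPQ. revert s. induction n as [|n IH]; intros s; simpl.
  - destruct (classic (P s)) as [H|H]; [|destruct (classic (Q s)) as [H'|H']].
    + rewrite (ind_true (_ \/ _)), (ind_true (P s)), (ind_false (Q s)); firstorder lra.
    + rewrite (ind_true (_ \/ _)), (ind_false (P s)), (ind_true (Q s)) by tauto. lra.
    + rewrite !ind_false by tauto. lra.
  - pose proof (IH (s ++ [false])). pose proof (IH (s ++ [true])). lra.
Qed.

Lemma density_true P s n : (forall r, P (s ++ r)) -> density P s n = 1.
Proof.
  revert s. induction n as [|n IH]; intros s H; simpl.
  - apply ind_true. specialize (H []). now rewrite app_nil_r in H.
  - rewrite !IH; [lra| |]; intros r; rewrite <- app_assoc; apply H.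
Qed.

Lemma density_false P s n : (forall r, ~ P (s ++ r)) -> density P s n = 0.
Proof.
  revert s. induction n as [|n IH]; intros s H; simpl.
  - apply ind_false. specialize (H []). now rewrite app_nil_r in H.
  - rewrite !IH; [lra| |]; intros r; rewrite <- app_assoc; apply H.
Qed.

Lemma density_step P s n : upward P -> density P s n <= density P s (S n).
Proof.
  intros HP. revert s. induction n as [|n IH]; intros s.
  - simpl. pose proof (ind_le _ _ (HP s false)). pose proof (ind_le _ _ (HP s true)). lra.
  - pose proof (IH (s ++ [false])). pose proof (IH (s ++ [true])). simpl in *. lra.
Qed.

Lemma density_mono P s n m : upward P -> (n <= m)%nat -> density P s n <= density P s m.
Proof.
  intros HP. induction 1 as [|m _ IH]; [lra|].
  pose proof (density_step P s m HP). lra.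
Qed.

Lemma density_firstn P s n k :
  density (fun t => P (firstn (length s + n) t)) s (n + k) = density P s n.
Proof.
  revert s. induction n as [|n IH]; intros s.
  - rewrite Nat.add_0_r. simpl.
    assert (E : forall r, firstn (length s) (s ++ r) = s).
    { intros r. rewrite firstn_app, firstn_all, Nat.sub_diag. simpl. apply app_nil_r. }
    destruct (classic (P s)) as [H|H].
    + rewrite ind_true by exact H. apply density_true. intros r. now rewrite E.
    + rewrite ind_false by exact H. apply density_false. intros r. now rewrite E.
  - simpl. rewrite <- (IH (s ++ [false])), <- (IH (s ++ [true])), !length_app.
    simpl length. replace (length s + 1 + n)%nat with (length s + S n)%nat by lia.
    reflexivity.
Qed.

Lemma density_cylinder u s n : density (spre (s ++ u)) s n <= (/2) ^ length u.
Proof.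
  revert s n. induction u as [|b u IH]; intros s n.
  - rewrite app_nil_r. simpl. rewrite density_true; [lra|]. intros r. now exists r.
  - destruct n as [|n].
    + simpl density. rewrite ind_false; [apply pow_le; lra|].
      intros H. apply spre_length in H. rewrite length_app in H. simpl in H. lia.
    + assert (Ho : density (spre (s ++ b :: u)) (s ++ [negb b]) n = 0).
      { apply density_false. intros r [q Hq]. rewrite <- !app_assoc in Hq. simpl in Hq.
        apply app_inv_head in Hq. destruct b; discriminate. }
      specialize (IH (s ++ [b]) n). rewrite <- app_assoc in IH. simpl app in IH.
      simpl. destruct b; simpl negb in Ho; rewrite Ho; simpl in IH; lra.
Qed.

Fixpoint rsum (f : nat -> R) (n : nat) : R :=
  match n with O => 0 | S n => rsum f n + f n end.

Lemma rsum_ext f g n : (forall k, (k < n)%nat -> f k = g k) -> rsum f n = rsum g n.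
Proof. induction n as [|n IH]; simpl; intros H; [reflexivity|]. rewrite IH, H; auto. Qed.

Lemma rsum_add f n m : rsum f (n + m) = rsum f n + rsum (fun k => f (n + k)%nat) m.
Proof.
  induction m as [|m IH]; simpl; [rewrite Nat.add_0_r; lra|].
  rewrite Nat.add_succ_r. simpl. rewrite IH. lra.
Qed.

Lemma rsum_scal c f n : rsum (fun k => c * f k) n = c * rsum f n.
Proof. induction n as [|n IH]; simpl; [|rewrite IH]; lra. Qed.

Lemma sum_n_rsum f n : sum_n f n = rsum f (S n).
Proof.
  induction n as [|n IH]; [rewrite sum_O; simpl; lra|].
  rewrite sum_Sn, IH. unfold plus; simpl. lra.
Qed.

Lemma rsum_mono f n m : (forall k, 0 <= f k) -> (n <= m)%nat -> rsum f n <= rsum f m.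
Proof. intros Hf. induction 1 as [|m _ IH]; [lra|]. simpl. specialize (Hf m). lra. Qed.

Lemma rsum_le f g n : (forall k, f k <= g k) -> rsum f n <= rsum g n.
Proof. intros H. induction n as [|n IH]; simpl; [lra|]. specialize (H n). lra. Qed.

Lemma density_finite_union (P : nat -> str -> Prop) s n m :
  density (fun t => exists i, (i < m)%nat /\ P i t) s n <= rsum (fun i => density (P i) s n) m.
Proof.
  induction m as [|m IH]; simpl rsum.
  - rewrite density_false; [lra|]. intros r [i [Hi _]]. lia.
  - apply Rle_trans with
      (density (fun t => (exists i, (i < m)%nat /\ P i t) \/ P m t) s n).
    + apply density_le. intros r _ [i [Hi H]].
      destruct (Nat.eq_dec i m) as [->|]; [now right|left]. exists i. split; [lia|exact H].
    + pose proof (density_or (fun t => exists i, (i < m)%nat /\ P i t) (P m) s n). lra.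
Qed.

(** * Open sets and the comparison of density with outer measure *)

Definition inside (A : cantor -> Prop) (s : str) : Prop := forall X, pre s X -> A X.

Definition open_set (A : cantor -> Prop) : Prop :=
  forall X, A X -> exists k, inside A (take X k).

Lemma inside_upward A : upward (inside A).
Proof.
  intros s b H X HX. apply H. apply pre_spre with (s ++ [b]); [now exists [b]|exact HX].
Qed.

Lemma inside_le (A B : cantor -> Prop) s : (forall X, A X -> B X) -> inside A s -> inside B s.
Proof. unfold inside. auto. Qed.

Lemma open_cylset U : open_set (cylset U).
Proof.
  intros X [s [Hs HX]]. exists (length s). rewrite <- (pre_eq_take s X HX).
  intros Z HZ. now exists s.
Qed.

Lemma open_union (A : nat -> cantor -> Prop) :
  (forall n, open_set (A n)) -> open_set (fun X => exists n, A n X).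
Proof.
  intros HA X [n H]. destruct (HA n X H) as [k Hk]. exists k.
  intros Z HZ. exists n. now apply Hk.
Qed.

Lemma open_or A B : open_set A -> open_set B -> open_set (fun X => A X \/ B X).
Proof.
  intros HA HB X [H|H]; [destruct (HA X H) as [k Hk]|destruct (HB X H) as [k Hk]];
    exists k; intros Z HZ; [left|right]; now apply Hk.
Qed.

Lemma density_compact (A : cantor -> Prop) (Q : nat -> str -> Prop) N :
  (forall n, upward (Q n)) -> (forall n s, Q n s -> Q (S n) s) ->
  (forall X, A X -> exists n k, Q n (take X k)) ->
  exists n, density (inside A) [] N <= density (Q n) [] n.
Proof.
  intros Hup Hmon HA.
  assert (Hle : forall n m s, (n <= m)%nat -> Q n s -> Q m s) by (induction 1; auto).
  (* The second alternative covers the complement of the compact set, so that all of Cantor space is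
     covered. *)
  destruct (heine_borel (fun n s =>
    Q n s \/ ((N <= length s)%nat /\ ~ inside A (firstn N s)))) as [n Hn].
  - intros n s b [H|[H H']]; [left; now apply Hup|right].
    rewrite length_app. split; [lia|].
    rewrite firstn_app. replace (N - length s)%nat with O by lia. simpl.
    now rewrite app_nil_r.
  - intros n s [H|H]; auto.
  - intros X. destruct (classic (A X)) as [H|H].
    + destruct (HA X H) as [n [k Hk]]. exists n, k. now left.
    + exists O, N. right. rewrite length_take. split; [lia|].
      rewrite firstn_all2 by now rewrite length_take.
      intros Hi. apply H, Hi, pre_take.
  - exists (N + n)%nat. rewrite <- (density_firstn (inside A) [] N n).
    apply density_le. simpl. intros s Hs Hi.
    destruct (Hn (firstn n s)) as [H|[H H']].
    + rewrite length_firstn. lia.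
    + apply Hle with n; [lia|]. rewrite <- (firstn_skipn n s).
      apply upward_app; [apply Hup|exact H].
    + exfalso. apply H'. rewrite length_firstn in H.
      rewrite firstn_firstn. now replace (Nat.min N n) with N by lia.
Qed.

Lemma cyl_weight_ge0 f n : 0 <= cyl_weight f n.
Proof. unfold cyl_weight. destruct (f n); [apply pow_le|]; lra. Qed.

Lemma series_partial_le (w : nat -> R) r n :
  (forall k, 0 <= w k) -> is_series w r -> rsum w n <= r.
Proof.
  intros Hw Hr. apply Rle_trans with (rsum w (S n)); [apply rsum_mono; auto|].
  rewrite <- sum_n_rsum.
  assert (Hinc : forall k, sum_n w k <= sum_n w (S k)).
  { intros k. rewrite sum_Sn. unfold plus; simpl. specialize (Hw (S k)). lra. }
  apply (is_lim_seq_incr_compare (sum_n w) r); [exact Hr|exact Hinc].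
Qed.

Lemma density_le_cover A f r N :
  covers A f -> is_series (cyl_weight f) r -> density (inside A) [] N <= r.
Proof.
  intros Hf Hr.
  destruct (density_compact A
    (fun n s => exists i, (i < n)%nat /\ exists u, f i = Some u /\ spre u s) N) as [n Hn].
  - intros n s b [i [Hi [u [Hu [r' ->]]]]]. exists i. split; [exact Hi|].
    exists u. split; [exact Hu|]. exists (r' ++ [b]). now rewrite app_assoc.
  - intros n s [i [Hi H]]. exists i. split; [lia|exact H].
  - intros X HX. destruct (Hf X HX) as [n [s [Hs Hp]]]. exists (S n), (length s), n.
    split; [lia|]. exists s. split; [exact Hs|]. now apply spre_take.
  - eapply Rle_trans; [exact Hn|]. eapply Rle_trans; [apply density_finite_union|].
    apply Rle_trans with (rsum (cyl_weight f) n).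
    + apply rsum_le. intros i. unfold cyl_weight. destruct (f i) as [u|].
      * apply Rle_trans with (density (spre ([] ++ u)) [] n); [|apply density_cylinder].
        apply density_le. intros q _ [u' [Hu Hq]]. injection Hu as ->. exact Hq.
      * rewrite density_false; [lra|]. intros q [u [Hu _]]. discriminate.
    + apply series_partial_le; [apply cyl_weight_ge0|exact Hr].
Qed.

Lemma trivial_cover A : exists f, covers A f /\ exists r, is_series (cyl_weight f) r.
Proof.
  exists (fun n => match n with O => Some [] | _ => None end). split.
  - intros X _. exists O, []. split; [reflexivity|]. intros i Hi. simpl in Hi. lia.
  - exists 1. change (is_lim_seq (sum_n (cyl_weight
      (fun n => match n with O => Some [] | _ => None end))) 1).
    apply (is_lim_seq_ext (fun _ => 1)); [|apply is_lim_seq_const].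
    induction n as [|n IH]; [rewrite sum_O; reflexivity|].
    rewrite sum_Sn, <- IH. unfold plus, cyl_weight; simpl. lra.
Qed.

(** [real] would turn an infinite value into 0. The infimum is finite, since it lies between 0 and
    the weight of the trivial cover. *)
Lemma lam_is_glb A :
  is_glb_Rbar (fun r => exists f, covers A f /\ is_series (cyl_weight f) r) (lam A).
Proof.
  unfold lam. set (E := fun r => _). pose proof (Glb_Rbar_correct E) as [Hlb Hg].
  assert (H0 : Rbar_le 0 (Glb_Rbar E)).
  { apply Hg. intros r [f [_ Hr]]. simpl.
    change 0 with (rsum (cyl_weight f) 0).
    apply series_partial_le; [apply cyl_weight_ge0|exact Hr]. }
  destruct (trivial_cover A) as [f [Hf [r Hr]]].
  assert (H1 : Rbar_le (Glb_Rbar E) r) by (apply Hlb; now exists f).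
  replace (Finite (real (Glb_Rbar E))) with (Glb_Rbar E); [now split|].
  destruct (Glb_Rbar E); try easy.
Qed.

Lemma density_le_lam A N : density (inside A) [] N <= lam A.
Proof.
  destruct (lam_is_glb A) as [_ Hg].
  specialize (Hg (Finite (density (inside A) [] N))). apply Hg.
  intros r [f [Hf Hr]]. now apply density_le_cover with f.
Qed.

Lemma lam_le_cover A f r : covers A f -> is_series (cyl_weight f) r -> lam A <= r.
Proof. intros Hf Hr. destruct (lam_is_glb A) as [Hlb _]. apply (Hlb r). now exists f. Qed.

Lemma lam_ge0 A : 0 <= lam A.
Proof. eapply Rle_trans; [|apply (density_le_lam A 0)]. apply density_ge0. Qed.

Lemma density_rsum P s n :
  density P s n =
  (/2) ^ n * rsum (fun k => ind (P (decode_str (pred (num s * 2 ^ n + k))))) (2 ^ n).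
Proof.
  revert s. induction n as [|n IH]; intros s.
  - simpl. rewrite Nat.mul_1_r, Nat.add_0_r, num_code. simpl. rewrite decode_code. lra.
  - simpl density. rewrite !IH, !num_app_bit.
    replace (2 ^ S n)%nat with (2 ^ n + 2 ^ n)%nat by (simpl; lia).
    rewrite rsum_add.
    rewrite (rsum_ext (fun k => ind (P (decode_str (pred
        ((2 * num s + 0) * 2 ^ n + k)))))
      (fun k => ind (P (decode_str (pred (num s * (2 ^ n + 2 ^ n) + k)))))).
    2:{ intros k _. do 4 f_equal. lia. }
    rewrite (rsum_ext (fun k => ind (P (decode_str (pred
        ((2 * num s + 1) * 2 ^ n + k)))))
      (fun k => ind (P (decode_str (pred (num s * (2 ^ n + 2 ^ n) + (2 ^ n + k))))))).
    2:{ intros k _. do 4 f_equal. lia. }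
    simpl pow. lra.
Qed.

(** * Optimal covers of open sets by minimal cylinders *)

Definition minimal (P : str -> Prop) (s : str) : Prop :=
  P s /\ forall t b, s = t ++ [b] -> ~ P t.

(** Among the extensions by [k + 1] bits, the minimal ones are disjoint from those whose predecessor
    already satisfies [P], and the latter keep the density of the previous depth. The inequality
    telescopes in [rsum_density_minimal]. *)
Lemma density_minimal P s k :
  upward P -> density (minimal P) s (S k) + density P s k <= density P s (S k).
Proof.
  intros HP. revert s. induction k as [|k IH]; intros s.
  - simpl. destruct (classic (P s)) as [H|H].
    + rewrite !(ind_false (minimal P _)).
      2,3: intros [_ H']; now apply (H' s _ eq_refl).
      pose proof (HP s false H). pose proof (HP s true H). rewrite !ind_true by auto. lra.
    + rewrite (ind_false (P s)) by auto.
      assert (Hm : forall t, ind (minimal P t) <= ind (P t)).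
      { intros t. apply ind_le. now intros [H' _]. }
      pose proof (Hm (s ++ [false])). pose proof (Hm (s ++ [true])). lra.
  - pose proof (IH (s ++ [false])). pose proof (IH (s ++ [true])). simpl in *. lra.
Qed.

Lemma length_decode k j : (j < 2 ^ k)%nat -> length (decode_str (pred (2 ^ k + j))) = k.
Proof.
  intros Hj. set (s := decode_str _).
  assert (E : num s = (2 ^ k + j)%nat).
  { unfold s. rewrite num_code, code_decode. pose proof (Nat.pow_nonzero 2 k). lia. }
  pose proof (num_bounds s) as [H1 H2]. rewrite E in H1, H2.
  destruct (lt_eq_lt_dec (length s) k) as [[H|H]|H]; auto.
  - pose proof (Nat.pow_le_mono_r 2 (S (length s)) k). lia.
  - pose proof (Nat.pow_le_mono_r 2 (S k) (length s)). simpl in *. lia.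
Qed.

Definition minimal_cover (P : str -> Prop) (n : nat) : option str :=
  if excluded_middle_informative (minimal P (decode_str n)) then Some (decode_str n) else None.

(** The codes below [2 ^ N - 1] are those of the strings shorter than [N]; grouped by length, each
    block contributes one density. *)
Lemma minimal_cover_weight P N :
  rsum (cyl_weight (minimal_cover P)) (pred (2 ^ N)) = rsum (density (minimal P) []) N.
Proof.
  induction N as [|N IH]; [reflexivity|].
  replace (pred (2 ^ S N)) with (pred (2 ^ N) + 2 ^ N)%nat.
  2:{ pose proof (Nat.pow_nonzero 2 N). simpl. lia. }
  rewrite rsum_add, IH. cbn [rsum]. f_equal. rewrite density_rsum, <- rsum_scal.
  apply rsum_ext. intros k Hk.
  replace (num [] * 2 ^ N + k)%nat with (2 ^ N + k)%nat by (unfold num; simpl; lia).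
  replace (pred (2 ^ N) + k)%nat with (pred (2 ^ N + k)).
  2:{ pose proof (Nat.pow_nonzero 2 N). lia. }
  unfold cyl_weight, minimal_cover, ind.
  destruct (excluded_middle_informative _); [|lra].
  rewrite length_decode by exact Hk. lra.
Qed.

Lemma rsum_density_minimal P N :
  upward P -> rsum (density (minimal P) []) (S N) <= density P [] N.
Proof.
  intros HP. induction N as [|N IH].
  - simpl. assert (ind (minimal P []) <= ind (P [])); [|lra].
    apply ind_le. now intros [H _].
  - simpl rsum in *. pose proof (density_minimal P [] N HP). simpl in *. lra.
Qed.

(** The minimal cylinders inside an open set are disjoint and cover it, and their partial weights
    never exceed a density of [inside A]. Together with [density_le_lam] this determines the measure
    of open sets. *)
Lemma lam_le_density A r :
  open_set A -> (forall N, density (inside A) [] N <= r) -> lam A <= r.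
Proof.
  intros HA Hr. set (f := minimal_cover (inside A)).
  assert (Hpart : forall n, sum_n (cyl_weight f) n <= r).
  { intros n. rewrite sum_n_rsum.
    apply Rle_trans with (rsum (cyl_weight f) (pred (2 ^ S (S n)))).
    - apply rsum_mono; [apply cyl_weight_ge0|].
      pose proof (Nat.pow_gt_lin_r 2 (S (S n))). lia.
    - unfold f. rewrite minimal_cover_weight.
      eapply Rle_trans; [apply rsum_density_minimal, inside_upward|apply Hr]. }
  destruct (ex_finite_lim_seq_incr (sum_n (cyl_weight f)) r) as [l Hl]; [|exact Hpart|].
  { intros k. rewrite sum_Sn. unfold plus; simpl.
    pose proof (cyl_weight_ge0 f (S k)). lra. }
  apply Rle_trans with l.
  - apply lam_le_cover with f; [|exact Hl].
    intros X HX.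
    (* The predicate is turned into a 0-1 function so that [least_zero] yields the shortest initial
       segment of [X] inside [A], which is a minimal string. *)
    assert (Hk : exists k, (if excluded_middle_informative (inside A (take X k))
                            then O else 1%nat) = O).
    { destruct (HA X HX) as [k Hk]. exists k.
      destruct (excluded_middle_informative (inside A (take X k))); tauto. }
    apply least_zero in Hk as [k [Hk Hmin]].
    destruct (excluded_middle_informative (inside A (take X k))) as [Hin|]; [|discriminate].
    exists (code_str (take X k)), (take X k). split; [|apply pre_take].
    unfold f, minimal_cover. rewrite decode_code.
    destruct (excluded_middle_informative (minimal (inside A) (take X k))) as [|Hno];
      [reflexivity|]. elim Hno. split; [exact Hin|].
    intros t b E Ht. destruct k as [|k]; [now destruct t|].
    rewrite take_S in E. apply app_inj_tail in E as [<- _].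
    apply (Hmin k); [lia|].
    destruct (excluded_middle_informative (inside A (take X k))); tauto.
  - apply (is_lim_seq_le (sum_n (cyl_weight f)) (fun _ => r) l r); auto.
    apply is_lim_seq_const.
Qed.

(** * Monotonicity, unions and additivity for open sets *)

Lemma lam_mono (A B : cantor -> Prop) : open_set A -> (forall X, A X -> B X) -> lam A <= lam B.
Proof.
  intros HA H. apply lam_le_density; [exact HA|]. intros N.
  eapply Rle_trans; [|apply (density_le_lam B N)].
  apply density_le. intros r _. now apply inside_le.
Qed.

Lemma lam_countable_union (A : nat -> cantor -> Prop) r :
  (forall n, open_set (A n)) -> (forall n, rsum (fun i => lam (A i)) n <= r) ->
  lam (fun X => exists n, A n X) <= r.
Proof.
  intros HA Hr. apply lam_le_density; [now apply open_union|]. intros N.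
  destruct (density_compact (fun X => exists n, A n X)
    (fun n s => exists i, (i < n)%nat /\ inside (A i) s) N) as [n Hn].
  - intros n s b [i [Hi H]]. exists i. split; [exact Hi|]. now apply inside_upward.
  - intros n s [i [Hi H]]. exists i. split; [lia|exact H].
  - intros X [n H]. destruct (HA n X H) as [k Hk]. exists (S n), k, n. split; [lia|exact Hk].
  - eapply Rle_trans; [exact Hn|]. eapply Rle_trans; [apply density_finite_union|].
    apply Rle_trans with (rsum (fun i => lam (A i)) n); [|apply Hr].
    apply rsum_le. intros i. apply density_le_lam.
Qed.

Lemma lam_increasing_union (A : nat -> cantor -> Prop) r :
  (forall n, open_set (A n)) -> (forall n X, A n X -> A (S n) X) ->
  (forall n, lam (A n) <= r) -> lam (fun X => exists n, A n X) <= r.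
Proof.
  intros HA Hmon Hr. apply lam_le_density; [now apply open_union|]. intros N.
  destruct (density_compact (fun X => exists n, A n X) (fun n => inside (A n)) N) as [n Hn].
  - intros n. apply inside_upward.
  - intros n s. apply inside_le. auto.
  - intros X [n H]. destruct (HA n X H) as [k Hk]. now exists n, k.
  - eapply Rle_trans; [exact Hn|]. eapply Rle_trans; [apply density_le_lam|apply Hr].
Qed.

Lemma lam_or_le A B :
  open_set A -> open_set B -> lam (fun X => A X \/ B X) <= lam A + lam B.
Proof.
  intros HA HB. apply lam_le_density; [now apply open_or|]. intros N.
  destruct (density_compact (fun X => A X \/ B X)
    (fun n s => inside A s \/ inside B s) N) as [n Hn].
  - intros n s b [H|H]; [left|right]; now apply inside_upward.
  - auto.
  - intros X [H|H]; [destruct (HA X H) as [k Hk]|destruct (HB X H) as [k Hk]];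
      exists O, k; auto.
  - eapply Rle_trans; [exact Hn|]. eapply Rle_trans; [apply density_or|].
    apply Rplus_le_compat; apply density_le_lam.
Qed.

Lemma pre_inhabited s : exists X, pre s X.
Proof. exists (fun i => nth i s false). now intros i Hi. Qed.

Lemma lam_disjoint_ge A B :
  open_set A -> open_set B -> (forall X, A X -> B X -> False) ->
  lam A + lam B <= lam (fun X => A X \/ B X).
Proof.
  intros HA HB Hdis. set (C := fun X => A X \/ B X).
  assert (H : forall N M, density (inside A) [] N + density (inside B) [] M <= lam C).
  { intros N M.
    pose proof (density_mono _ [] N (N + M) (inside_upward A) ltac:(lia)).
    pose proof (density_mono _ [] M (N + M) (inside_upward B) ltac:(lia)).
    pose proof (density_disjoint (inside A) (inside B) [] (N + M)) as Hd.
    pose proof (density_le (fun t => inside A t \/ inside B t) (inside C) [] (N + M)) as Hl.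
    pose proof (density_le_lam C (N + M)).
    enough (density (inside A) [] (N + M) + density (inside B) [] (N + M) <=
            density (fun t => inside A t \/ inside B t) [] (N + M) /\
            density (fun t => inside A t \/ inside B t) [] (N + M) <=
            density (inside C) [] (N + M)) by lra.
    split.
    - apply Hd. intros t Ha Hb. destruct (pre_inhabited t) as [X HX]. eauto.
    - apply Hl. intros r _ [Ha|Hb]; intros X HX; [left|right]; auto. }
  (* The two suprema are taken one after the other, first over the depth for [B] and then over the
     depth for [A]. *)
  assert (HB' : forall N, lam B <= lam C - density (inside A) [] N).
  { intros N. apply lam_le_density; [exact HB|]. intros M. specialize (H N M). lra. }
  assert (lam A <= lam C - lam B).
  { apply lam_le_density; [exact HA|]. intros N. specialize (HB' N). lra. }
  lra.
Qed.

Definition has_prefix (S : str -> Prop) (s : str) : Prop := exists u, spre u s /\ S u.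

Lemma has_prefix_upward S : upward (has_prefix S).
Proof.
  intros s b [u [Hu H]]. exists u. split; [|exact H].
  apply spre_trans with s; [exact Hu|now exists [b]].
Qed.

Lemma has_prefix_inside S s : has_prefix S s -> inside (cylset S) s.
Proof. intros [u [Hu H]] X HX. exists u. split; [exact H|]. now apply pre_spre with s. Qed.

Lemma density_has_prefix_le S N : density (has_prefix S) [] N <= lam (cylset S).
Proof.
  eapply Rle_trans; [|apply (density_le_lam _ N)].
  apply density_le. intros r _. apply has_prefix_inside.
Qed.

(** When no generator is longer than [t], membership is settled by the first [t] bits, so the
    density at depth [t] is already the full measure. *)
Lemma lam_clopen_le S t :
  (forall u, S u -> (length u <= t)%nat) -> lam (cylset S) <= density (has_prefix S) [] t.
Proof.
  intros HS. apply lam_le_density; [apply open_cylset|]. intros N.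
  destruct (density_compact (cylset S) (fun _ => has_prefix S) N) as [n Hn].
  - intros _. apply has_prefix_upward.
  - auto.
  - intros X [u [Hu HX]]. exists O, (length u), u. split; [|exact Hu]. now apply spre_take.
  - eapply Rle_trans; [exact Hn|].
    apply Rle_trans with (density (has_prefix S) [] (t + n)).
    + apply density_mono; [apply has_prefix_upward|lia].
    + rewrite <- (density_firstn (has_prefix S) [] t n). apply density_le.
      simpl. intros s Hs [u [[r ->] Hu]]. exists u. split; [|exact Hu].
      rewrite firstn_app. rewrite firstn_all2 by now apply HS. eexists. reflexivity.
Qed.

(** * Stages and the universal test *)

Lemma INR_bsum f n : INR (bsum f n) = rsum (fun k => INR (f k)) n.
Proof. induction n as [|n IH]; [reflexivity|]. simpl bsum. rewrite plus_INR, IH. reflexivity. Qed.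

(** Clearing denominators makes bounds on the measure of a stage decidable. *)
Lemma dyadic_le a t m : INR a * (/2) ^ t <= (/2) ^ m <-> (a * 2 ^ m <= 2 ^ t)%nat.
Proof.
  rewrite !pow_inv.
  assert (Ht : 0 < 2 ^ t) by (apply pow_lt; lra).
  assert (Hm : 0 < 2 ^ m) by (apply pow_lt; lra).
  assert (E : forall k, INR (2 ^ k) = 2 ^ k) by (intros k; now rewrite pow_INR).
  split; intros H.
  - apply INR_le. rewrite mult_INR, !E.
    apply Rmult_le_compat_r with (r := 2 ^ t * 2 ^ m) in H; [|nra].
    replace (INR a * / 2 ^ t * (2 ^ t * 2 ^ m)) with (INR a * 2 ^ m) in H by (field; lra).
    replace (/ 2 ^ m * (2 ^ t * 2 ^ m)) with (2 ^ t) in H by (field; lra). exact H.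
  - apply le_INR in H. rewrite mult_INR, !E in H.
    apply Rmult_le_reg_r with (2 ^ t * 2 ^ m); [nra|].
    replace (INR a * / 2 ^ t * (2 ^ t * 2 ^ m)) with (INR a * 2 ^ m) by (field; lra).
    replace (/ 2 ^ m * (2 ^ t * 2 ^ m)) with (2 ^ t) by (field; lra). exact H.
Qed.

Lemma half_pow_pos n : 0 < (/2) ^ n.
Proof. apply pow_lt. lra. Qed.

Lemma rsum_half_pow k n : rsum (fun e => (/2) ^ (e + S k)) n <= (/2) ^ k.
Proof.
  assert (H : rsum (fun e => (/2) ^ (e + S k)) n = (/2) ^ k - (/2) ^ (n + k)).
  { induction n as [|n IH]; [simpl; lra|]. simpl rsum. rewrite IH.
    rewrite Nat.add_succ_r. simpl. lra. }
  rewrite H. pose proof (half_pow_pos (n + k)). lra.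
Qed.

Lemma lam_ext (A B : cantor -> Prop) : (forall X, A X <-> B X) -> lam A = lam B.
Proof.
  intros H. replace A with B; [reflexivity|].
  apply functional_extensionality. intros X. apply propositional_extensionality.
  symmetry. apply H.
Qed.

(* As [code_str] dominates the length, [stage_bounded] bounds the lengths of the strings
   enumerated by stage [t], so that [cn x t / 2^t] is the exact measure of that stage. *)
Record staging (R : nat -> nat -> Prop) (St : nat -> nat -> nat -> Prop)
    (cn : nat -> nat -> nat) : Prop := {
  stage_dec : rdec (fun z => St (p1 z) (p1 (p2 z)) (p2 (p2 z)));
  stage_count_computable : computable_fun (fun z => cn (p1 z) (p2 z));
  stage_bounded : forall x t s, St x t s -> (s < t)%nat;
  stage_mono : forall x t t' s, (t <= t')%nat -> St x t s -> St x t' s;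
  stage_limit : forall x s, R x s <-> exists t, St x t s;
  stage_density : forall x t,
    density (has_prefix (fun u => St x t (code_str u))) [] t = INR (cn x t) * (/2) ^ t }.

Lemma staging_exists R :
  sigma1 (fun z => R (p1 z) (p2 z)) -> exists St cn, staging R St cn.
Proof.
  intros H. destruct (sigma1_elim _ H) as [Q [HQ HR]].
  set (St := fun x t s => (s < t)%nat /\ exists u, (u < t)%nat /\ Q (npair x s) u).
  assert (Hdec : rdec (fun z => St (p1 z) (p1 (p2 z)) (p2 (p2 z)))).
  { unfold St. apply rdec_and; [apply rdec_lt; solve_computable|].
    apply (rdec_bex (fun u z => Q (npair (p1 z) (p2 (p2 z))) u)); [|solve_computable].
    apply (rdec_app2 Q _ _ HQ); solve_computable. }
  (* With [z] holding [k], [x] and [t], the number [pred (2 ^ t + k)] for [k < 2 ^ t] runs through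
     the codes of the strings of length [t]. Then [cn] counts those with a prefix in stage [t]. *)
  destruct (computable_ite (fun z => exists s, (s < p2 (p2 z))%nat /\
      (St (p1 (p2 z)) (p2 (p2 z)) s /\ nprefix s (pred (2 ^ p2 (p2 z) + p1 z)))))
    as [chi [Hchi Hspec]].
  { apply (rdec_bex (fun s z => St (p1 (p2 z)) (p2 (p2 z)) s /\
      nprefix s (pred (2 ^ p2 (p2 z) + p1 z)))); [|solve_computable].
    apply rdec_and; [apply (rdec_app3 St)|apply rdec_nprefix]; solve_computable. }
  set (cn := fun x t => bsum (fun k => chi (npair k (npair x t))) (2 ^ t)).
  exists St, cn. split.
  - exact Hdec.
  - apply (computable_bsum (fun k z => chi (npair k (npair (p1 z) (p2 z))))
      (fun z => (2 ^ p2 z)%nat)); [|solve_computable].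
    apply (computable_comp chi); solve_computable.
  - now intros x t s [Hs _].
  - intros x t t' s Ht [Hs [u [Hu HQu]]]. split; [lia|]. exists u. split; [lia|exact HQu].
  - intros x s. specialize (HR (npair x s)). rewrite p1_npair, p2_npair in HR. rewrite HR.
    split.
    + intros [u Hu]. exists (S (u + s)). split; [lia|]. exists u. split; [lia|exact Hu].
    + intros [t [_ [u [_ Hu]]]]. now exists u.
  - intros x t. rewrite density_rsum. unfold cn. rewrite INR_bsum, Rmult_comm. f_equal.
    apply rsum_ext. intros k _.
    replace (num [] * 2 ^ t + k)%nat with (2 ^ t + k)%nat by (unfold num; simpl; lia).
    set (r := decode_str (pred (2 ^ t + k))).
    specialize (Hspec (npair k (npair x t))).
    cbv beta in Hspec. repeat rewrite ?p1_npair, ?p2_npair in Hspec.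
    assert (Hr : code_str r = pred (2 ^ t + k)) by apply code_decode.
    rewrite <- Hr in Hspec. destruct Hspec as [H1 H0].
    destruct (classic (has_prefix (fun u => St x t (code_str u)) r)) as [Hp|Hp].
    + rewrite ind_true by exact Hp. destruct Hp as [u [Hu HS]].
      rewrite H1; [reflexivity|]. exists (code_str u).
      split; [apply HS|]. split; [exact HS|]. now apply nprefix_code.
    + rewrite ind_false by exact Hp. rewrite H0; [reflexivity|].
      intros [s [_ [HS Hn]]]. apply Hp. exists (decode_str s).
      rewrite code_decode. split; [|exact HS].
      apply nprefix_code. now rewrite code_decode.
Qed.

Section Stages.
Context {R : nat -> nat -> Prop} {St : nat -> nat -> nat -> Prop} {cn : nat -> nat -> nat}
  (HSt : staging R St cn).

Lemma stage_length x t u : St x t (code_str u) -> (length u <= t)%nat.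
Proof.
  intros H. apply (stage_bounded _ _ _ HSt) in H. pose proof (length_le_code u). lia.
Qed.

Lemma stage_lam_le x t : lam (cylset (fun u => St x t (code_str u))) <= INR (cn x t) * (/2) ^ t.
Proof.
  rewrite <- (stage_density _ _ _ HSt). apply lam_clopen_le. apply stage_length.
Qed.

Lemma stage_lam_ge x t : INR (cn x t) * (/2) ^ t <= lam (cylset (fun u => St x t (code_str u))).
Proof. rewrite <- (stage_density _ _ _ HSt). apply density_has_prefix_le. Qed.

Lemma stage_cylset x X :
  cylset (fun u => R x (code_str u)) X <-> exists t, cylset (fun u => St x t (code_str u)) X.
Proof.
  split.
  - intros [u [Hu HX]]. apply (stage_limit _ _ _ HSt) in Hu as [t Ht]. exists t, u. auto.
  - intros [t [u [Hu HX]]]. exists u. split; [|exact HX].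
    apply (stage_limit _ _ _ HSt). now exists t.
Qed.

Lemma stage_lam_limit x r :
  (forall t, lam (cylset (fun u => St x t (code_str u))) <= r) ->
  lam (cylset (fun u => R x (code_str u))) <= r.
Proof.
  intros H. eapply Rle_trans.
  - apply lam_mono; [apply open_cylset|]. intros X HX. apply stage_cylset in HX. exact HX.
  - apply (lam_increasing_union (fun t => cylset (fun u => St x t (code_str u))));
      [intros; apply open_cylset| |exact H].
    intros t X [u [Hu HX]]. exists u. split; [|exact HX].
    apply (stage_mono _ _ _ HSt) with t; [lia|exact Hu].
Qed.

End Stages.

Definition level (W : nat -> nat -> Prop) (i : nat) : cantor -> Prop :=
  cylset (fun s => W i (code_str s)).

(* The [e]-th c.e. set contributes its level [e + i + 2], enumerated only as long as
   the measure stays below [2^-(e+i+2)]. *)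
Lemma universal_test :
  exists U : nat -> nat -> Prop,
    sigma1 (fun z => U (p1 z) (p2 z)) /\
    (forall i, lam (level U i) <= (/2) ^ S i) /\
    (forall Z i, ~ level U i Z -> MLR Z).
Proof.
  destruct (staging_exists (fun x s => universal (p1 x) (npair (p2 x) s)))
    as [St [cn HSt]].
  { apply (sigma1_app2 universal); [apply sigma1_universal|solve_computable..]. }
  set (idx := fun e i => npair e (e + S (S i))).
  set (good := fun e i t => (cn (idx e i) t * 2 ^ (e + S (S i)) <= 2 ^ t)%nat).
  set (U := fun i s => exists e t, St (idx e i) t s /\ good e i t).
  exists U. split; [|split].
  - unfold U, good, idx.
    apply (sigma1_ex (fun e z => exists t, St (npair e (e + S (S (p1 z)))) t (p2 z) /\
      (cn (npair e (e + S (S (p1 z)))) t * 2 ^ (e + S (S (p1 z))) <= 2 ^ t)%nat)).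
    apply (sigma1_ex (fun t z =>
      St (npair (p1 z) (p1 z + S (S (p1 (p2 z))))) t (p2 (p2 z)) /\
      (cn (npair (p1 z) (p1 z + S (S (p1 (p2 z))))) t * 2 ^ (p1 z + S (S (p1 (p2 z))))
         <= 2 ^ t)%nat)).
    apply sigma1_rdec, rdec_and.
    + apply (rdec_app3 St _ _ _ (stage_dec _ _ _ HSt)); solve_computable.
    + apply rdec_le; [|solve_computable].
      apply computable_mul; [|solve_computable].
      apply (computable_app2 cn _ _ (stage_count_computable _ _ _ HSt)); solve_computable.
  - intros i.
    set (B := fun e t => cylset (fun s =>
      exists t', (t' <= t)%nat /\ St (idx e i) t' (code_str s) /\ good e i t')).
    assert (HB : forall e t, lam (B e t) <= (/2) ^ (e + S (S i))).
    { intros e t. induction t as [|t IH].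
      - eapply Rle_trans; [apply (lam_mono _ (cylset (fun _ => False)))|].
        + apply open_cylset.
        + intros X [s [[t' [Ht' [Hs _]]] _]].
          apply (stage_bounded _ _ _ HSt) in Hs. lia.
        + eapply Rle_trans; [apply (lam_clopen_le _ 0); easy|].
          rewrite density_false; [apply Rlt_le, half_pow_pos|]. now intros r [u [_ Hu]].
      - destruct (classic (good e i (S t))) as [Hg|Hg].
        + eapply Rle_trans;
            [apply (lam_mono _ (cylset (fun s => St (idx e i) (S t) (code_str s))))|].
          * apply open_cylset.
          * intros X [s [[t' [Ht' [Hs _]]] HX]]. exists s. split; [|exact HX].
            now apply (stage_mono _ _ _ HSt) with t'.
          * eapply Rle_trans; [apply (stage_lam_le HSt)|]. now apply dyadic_le.
        + eapply Rle_trans; [|exact IH]. apply lam_mono; [apply open_cylset|].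
          intros X [s [[t' [Ht' [Hs Hg']]] HX]]. exists s. split; [|exact HX].
          exists t'. split; [|now split].
          destruct (Nat.eq_dec t' (S t)) as [->|]; [contradiction|lia]. }
    eapply Rle_trans; [apply (lam_mono _ (fun X => exists e, exists t, B e t X))|].
    + apply open_cylset.
    + intros X [s [[e [t [Hs Hg]]] HX]]. exists e, t, s. split; [|exact HX].
      exists t. split; [lia|now split].
    + apply lam_countable_union.
      * intros e. apply open_union. intros t. apply open_cylset.
      * intros n. eapply Rle_trans; [|apply (rsum_half_pow (S i) n)].
        apply rsum_le. intros e.
        apply lam_increasing_union; [intros t; apply open_cylset| |apply HB].
        intros t X [s [[t' [Ht' Hs]] HX]]. exists s. split; [|exact HX].
        exists t'. split; [lia|exact Hs].
  - intros Z i HZ W [Hce HW] Hall. destruct (universal_ce W Hce) as [e He].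
    destruct (Hall (e + S (S i))%nat) as [s [Hs HX]].
    assert (HR : forall u, W (npair (e + S (S i)) (code_str u)) <->
              universal (p1 (idx e i)) (npair (p2 (idx e i)) (code_str u))).
    { intros u. unfold idx. rewrite p1_npair, p2_npair. apply He. }
    apply HR in Hs. apply (stage_limit _ _ _ HSt) in Hs as [t Ht].
    apply HZ. exists s. split; [|exact HX]. exists e, t. split; [exact Ht|].
    (* The chosen level of a genuine test never exceeds its bound, so each of its stages passes the
       check and nothing of it is cut off. *)
    apply dyadic_le. eapply Rle_trans; [apply (stage_lam_ge HSt)|].
    eapply Rle_trans; [|apply HW]. apply lam_mono; [apply open_cylset|].
    intros X [u [Hu HXu]]. exists u. split; [|exact HXu].
    apply HR. apply (stage_limit _ _ _ HSt). now exists t.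
Qed.

(** * Turing functionals *)

Lemma out_unique F X i b b' :
  turing_functional F -> out F X i b -> out F X i b' -> b = b'.
Proof.
  intros [_ HF].
  assert (H : forall s t s' t', F s t -> F s' t' -> pre s X -> pre s' X ->
    (i < length t)%nat -> (i < length t')%nat -> nth i t false = nth i t' false).
  { intros s t s' t' H1 H2 HX HX' Hi Hi'.
    assert (Hc : spre t t' \/ spre t' t).
    { destruct (le_ge_dec (length s) (length s')) as [Hl|Hl].
      - apply (HF s t s' t'); auto. now apply pre_pre_spre with X.
      - apply or_comm. apply (HF s' t' s t); auto. now apply pre_pre_spre with X. }
    destruct Hc as [[r ->]|[r ->]]; rewrite app_nth1; auto. }
  intros [s [t [H1 [HX [Hi <-]]]]] [s' [t' [H2 [HX' [Hi' <-]]]]]. eauto.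
Qed.

(* The empty string is a separate case because [F] need not contain any pair. *)
Definition gen (F : str -> str -> Prop) (a s : nat) : Prop :=
  a = code_str [] \/
  exists t, (exists s' t', npair s t = code_pair s' t' /\ F s' t') /\ nprefix a t.

Lemma gen_code F u s :
  gen F (code_str u) (code_str s) <-> u = [] \/ exists t, F s t /\ spre u t.
Proof.
  unfold gen. split.
  - intros [H|[t [[s' [t' [E HF]]] Hn]]]; [left; now apply code_str_inj|right].
    apply npair_inj in E as [Es ->]. apply code_str_inj in Es as ->.
    exists t'. split; [exact HF|]. now apply nprefix_code.
  - intros [->|[t [HF Ht]]]; [now left|right]. exists (code_str t).
    split; [now exists s, t|]. now apply nprefix_code.
Qed.

Lemma sigma1_gen F : turing_functional F -> sigma1 (fun z => gen F (p1 z) (p2 z)).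
Proof.
  intros [Hce _]. apply ce_sigma1 in Hce. unfold gen.
  apply sigma1_or; [apply sigma1_rdec, rdec_eq; solve_computable|].
  apply (sigma1_ex (fun t z =>
    (exists s' t', npair (p2 z) t = code_pair s' t' /\ F s' t') /\ nprefix (p1 z) t)).
  apply sigma1_and; [|apply sigma1_rdec, rdec_nprefix; solve_computable].
  apply (sigma1_subst (fun n => exists s t, n = code_pair s t /\ F s t) _ Hce).
  solve_computable.
Qed.

(** By definition the bits of the output may come from different pairs of [F]. The pair giving the
    last bit of [u] has an output at least as long as [u], and by consistency that output agrees
    with [u] at all earlier bits, so one pair suffices. *)
Lemma out_ext_gen F X u :
  turing_functional F -> out_ext F X u <-> level (gen F) (code_str u) X.
Proof.
  intros HF. split.
  - intros H. destruct u as [|b u _] using rev_ind.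
    + exists []. split; [now left|]. intros i Hi. simpl in Hi. lia.
    + assert (Hl : (length u < length (u ++ [b]))%nat) by (rewrite length_app; simpl; lia).
      destruct (H _ Hl) as [s [t [Hst [HX [Hi Hb]]]]].
      exists s. split; [|exact HX]. apply gen_code. right. exists t. split; [exact Hst|].
      exists (skipn (length (u ++ [b])) t).
      rewrite <- (firstn_skipn (length (u ++ [b])) t) at 1. f_equal.
      assert (Hlen : (length (u ++ [b]) <= length t)%nat).
      { rewrite length_app. simpl. lia. }
      apply nth_ext with false false; [rewrite length_firstn; lia|].
      intros i Hi'. rewrite length_firstn in Hi'.
      rewrite nth_firstn. destruct (Nat.ltb_spec i (length (u ++ [b]))); [|lia].
      apply (out_unique F X i); [exact HF| |apply H; lia].
      exists s, t. repeat split; auto. lia.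
  - intros [s [Hg HX]] i Hi. apply gen_code in Hg as [->|[t [Hst [r ->]]]]; [simpl in Hi; lia|].
    exists s, (u ++ r). split; [exact Hst|]. split; [exact HX|].
    rewrite length_app, app_nth1 by exact Hi. split; [lia|reflexivity].
Qed.

Lemma open_out_ext F u : turing_functional F -> open_set (fun X => out_ext F X u).
Proof.
  intros HF X H. apply (out_ext_gen F X u HF) in H.
  destruct (open_cylset _ X H) as [k Hk]. exists k. intros Z HZ.
  apply out_ext_gen; [exact HF|]. now apply Hk.
Qed.

Lemma lam_Phi_gen F u : turing_functional F -> lam_Phi F u = lam (level (gen F) (code_str u)).
Proof. intros HF. apply lam_ext. intros X. now apply out_ext_gen. Qed.

Lemma out_ext_app F X u r : out_ext F X (u ++ r) -> out_ext F X u.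
Proof.
  intros H i Hi. rewrite <- (app_nth1 u r) by exact Hi. apply H. rewrite length_app. lia.
Qed.

(** The union of the sets [out_ext F _ v] over the [v] in [G] that extend [u] by at most [n] bits.
    The recursion along the tree of outputs lets measures be compared by induction on [n]. *)
Fixpoint image_cover (F : str -> str -> Prop) (G : nat -> Prop) (u : str) (n : nat)
    (X : cantor) : Prop :=
  (G (code_str u) /\ out_ext F X u) \/
  match n with
  | O => False
  | S n => image_cover F G (u ++ [false]) n X \/ image_cover F G (u ++ [true]) n X
  end.

Lemma image_cover_out_ext F G n : forall u X, image_cover F G u n X -> out_ext F X u.
Proof.
  induction n as [|n IH]; intros u X; simpl.
  - tauto.
  - intros [H|[H|H]]; [tauto| |]; apply IH in H; now apply out_ext_app in H.
Qed.

Lemma image_cover_elim F G n : forall u X,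
  image_cover F G u n X -> exists v, G (code_str v) /\ out_ext F X v.
Proof.
  induction n as [|n IH]; intros u X; simpl.
  - intros [H|[]]. now exists u.
  - intros [H|[H|H]]; [now exists u| |]; now apply IH in H.
Qed.

Lemma image_cover_intro F G X r : forall u,
  G (code_str (u ++ r)) -> out_ext F X (u ++ r) -> image_cover F G u (length r) X.
Proof.
  induction r as [|b r IH]; intros u HG HX.
  - rewrite app_nil_r in *. now left.
  - right. change (b :: r) with ([b] ++ r) in *. rewrite app_assoc in *.
    destruct b; [right|left]; now apply IH.
Qed.

Lemma image_cover_step F G n : forall u X, image_cover F G u n X -> image_cover F G u (S n) X.
Proof.
  induction n as [|n IH]; intros u X [H|H]; [now left|easy|now left|].
  right. destruct H as [H|H]; [left|right]; now apply IH.
Qed.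

Lemma open_image_cover F G n :
  turing_functional F -> forall u, open_set (image_cover F G u n).
Proof.
  intros HF.
  assert (H0 : forall u, open_set (fun X => G (code_str u) /\ out_ext F X u)).
  { intros u X [HG HX]. destruct (open_out_ext F u HF X HX) as [k Hk].
    exists k. intros Z HZ. split; [exact HG|]. now apply Hk. }
  induction n as [|n IH]; intros u; simpl.
  - apply open_or; [apply H0|]. now intros X [].
  - apply open_or; [apply H0|]. now apply open_or.
Qed.

(* Peeling off the shortest elements of [G] first writes the covered set as a disjoint
   union of sets [out_ext F _ v], whose measures do not depend on the functional. *)
Lemma lam_image_cover Phi Psi G n :
  turing_functional Phi -> turing_functional Psi ->
  (forall u, lam_Phi Phi u = lam_Phi Psi u) ->
  forall u, lam (image_cover Phi G u n) <= lam (image_cover Psi G u n).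
Proof.
  intros HPhi HPsi Heq.
  assert (Hin : forall m u, G (code_str u) ->
    lam (image_cover Phi G u m) <= lam (image_cover Psi G u m)).
  { intros m u HG. apply Rle_trans with (lam_Phi Phi u); [|rewrite Heq].
    - apply lam_mono; [now apply open_image_cover|]. intros X. apply image_cover_out_ext.
    - apply lam_mono; [now apply open_out_ext|]. intros X HX. destruct m; now left. }
  induction n as [|n IH]; intros u; destruct (classic (G (code_str u))) as [HG|HG]; auto.
  - eapply Rle_trans; [|apply lam_ge0].
    eapply Rle_trans; [apply (lam_mono _ (cylset (fun _ => False)))|].
    + now apply open_image_cover.
    + intros X [[H _]|[]]. contradiction.
    + eapply Rle_trans; [apply (lam_clopen_le _ 0); easy|].
      rewrite density_false; [lra|]. now intros r [v [_ Hv]].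
  - eapply Rle_trans; [apply (lam_mono _ (fun X => image_cover Phi G (u ++ [false]) n X \/
                                           image_cover Phi G (u ++ [true]) n X))|].
    + now apply open_image_cover.
    + intros X [[H _]|H]; [contradiction|exact H].
    + eapply Rle_trans; [apply lam_or_le; now apply open_image_cover|].
      eapply Rle_trans; [apply Rplus_le_compat; apply IH|].
      eapply Rle_trans; [apply lam_disjoint_ge; try now apply open_image_cover|].
      (* The two parts prescribe different output bits at position [length u]. *)
      * intros X H0 H1. apply image_cover_out_ext in H0, H1.
        assert (Hl : forall b, (length u < length (u ++ [b]))%nat).
        { intros b. rewrite length_app. simpl. lia. }
        specialize (H0 _ (Hl false)). specialize (H1 _ (Hl true)).
        rewrite nth_middle in H0, H1.
        discriminate (out_unique Psi X _ _ _ HPsi H0 H1).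
      * apply lam_mono; [apply open_or; now apply open_image_cover|].
        intros X H. now right.
Qed.

(** A c.e. open set is approximated from below by its stages at an unknown rate. Knowing the measure
    to any precision makes it possible to recognise a stage that is close enough, hence to find one
    by search. *)
Lemma approximation_time F g St cn :
  turing_functional F -> staging (gen F) St cn -> computable_fun g ->
  (forall u i, Rabs (lam_Phi F u - dec_rat (g (npair (code_str u) i))) <= (/2) ^ i) ->
  exists T : nat -> nat -> nat, computable_fun (fun z => T (p1 z) (p2 z)) /\
    forall a i, lam (level (gen F) a) <=
                lam (cylset (fun s => St a (T a i) (code_str s))) + (/2) ^ (a + S (S i)).
Proof.
  intros HF HSt Hg Happ.
  (* The error allowed is [2^-(a+i+2)]. Two further bits leave room for four errors [2^-j], of which
     three occur: one in the rational [q] and two in the tolerance of [P]. *)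
  set (j := fun z => (p1 z + (p2 z + 4))%nat).
  set (q := fun z => g (npair (p1 z) (j z))).
  (* The inequality says that [q] exceeds the measure of stage [t] by at most [2 * 2^-j], multiplied
     out to natural numbers. A nonzero sign field makes the rational at most 0, and then every stage
     will do. *)
  set (P := fun z t => p1 (p1 (q z)) <> 0%nat \/
    (p2 (p1 (q z)) * (2 ^ t * 2 ^ j z) <=
     (cn (p1 z) t * 2 ^ j z + 2 * 2 ^ t) * S (p2 (q z)))%nat).
  assert (Hq : forall z, Rabs (lam (level (gen F) (p1 z)) - dec_rat (q z)) <= (/2) ^ j z).
  { intros z. specialize (Happ (decode_str (p1 z)) (j z)).
    now rewrite lam_Phi_gen, code_decode in Happ by exact HF. }
  assert (HP : forall z t, P z t <-> p1 (p1 (q z)) <> 0%nat \/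
    INR (p2 (p1 (q z))) / INR (S (p2 (q z))) <=
    INR (cn (p1 z) t) * (/2) ^ t + 2 * (/2) ^ j z).
  { intros z t. unfold P. apply or_iff_compat_l.
    set (n := p2 (p1 (q z))). set (b := S (p2 (q z))). set (c := cn (p1 z) t).
    assert (Hb : 0 < INR b) by (apply lt_0_INR; unfold b; lia).
    assert (Ht : 0 < 2 ^ t) by (apply pow_lt; lra).
    assert (Hj : 0 < 2 ^ j z) by (apply pow_lt; lra).
    assert (E : forall k, INR (2 ^ k) = 2 ^ k) by (intros k; now rewrite pow_INR).
    assert (Hpos : 0 < INR b * (2 ^ t * 2 ^ j z)).
    { apply Rmult_lt_0_compat; [exact Hb|]. now apply Rmult_lt_0_compat. }
    rewrite !pow_inv.
    assert (E1 : INR n / INR b * (INR b * (2 ^ t * 2 ^ j z)) = INR n * (2 ^ t * 2 ^ j z))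
      by (field; lra).
    assert (E2 : (INR c * / 2 ^ t + 2 * / 2 ^ j z) * (INR b * (2 ^ t * 2 ^ j z)) =
                 (INR c * 2 ^ j z + 2 * 2 ^ t) * INR b) by (field; lra).
    split; intros H.
    - apply Rmult_le_reg_r with (INR b * (2 ^ t * 2 ^ j z)); [exact Hpos|].
      rewrite E1, E2. apply le_INR in H.
      now rewrite !mult_INR, plus_INR, !mult_INR, !E in H.
    - apply Rmult_le_compat_r with (r := INR b * (2 ^ t * 2 ^ j z)) in H; [|lra].
      rewrite E1, E2 in H. apply INR_le.
      now rewrite !mult_INR, plus_INR, !mult_INR, !E. }
  destruct (computable_min P) as [h [Hh Hspec]].
  - unfold P, q, j.
    assert (Hgc : computable_fun (fun z => g (npair (p1 (p1 z)) (p1 (p1 z) + (p2 (p1 z) + 4))))).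
    { apply (computable_comp g); solve_computable. }
    apply rdec_or; [apply rdec_not, rdec_eq; solve_computable|].
    apply rdec_le; solve_computable.
    apply (computable_app2 cn _ _ (stage_count_computable _ _ _ HSt)); solve_computable.
  (* If the search never succeeded, all stages would stay below the limit measure by [2^-j], and so
     would their union. *)
  - intros z. apply NNPP. intros Hno.
    assert (Hall : forall t, lam (cylset (fun s => St (p1 z) t (code_str s))) <=
                     lam (level (gen F) (p1 z)) - (/2) ^ j z).
    { intros t. pose proof (not_ex_all_not _ _ Hno t) as H. cbv beta in H.
      rewrite HP in H. apply not_or_and in H as [H0 H1]. apply NNPP in H0.
      specialize (Hq z). rewrite dec_rat_eq, H0 in Hq. simpl Nat.eqb in Hq. cbv iota in Hq.
      rewrite Rmult_1_l in Hq. apply Rabs_le_between in Hq.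
      pose proof (stage_lam_le HSt (p1 z) t). lra. }
    apply (stage_lam_limit HSt) in Hall.
    change (cylset (fun u => gen F (p1 z) (code_str u))) with (level (gen F) (p1 z)) in Hall.
    pose proof (half_pow_pos (j z)). lra.
  - exists (fun a i => h (npair a i)). split.
    { apply (computable_comp h); solve_computable. }
    intros a i. specialize (Hspec (npair a i)). specialize (Hq (npair a i)).
    rewrite HP in Hspec. pose proof (stage_lam_ge HSt a (h (npair a i))) as Hge.
    set (z := npair a i) in *.
    assert (Ha : p1 z = a) by apply p1_npair.
    assert (Hj : (/2) ^ (a + S (S i)) = 4 * (/2) ^ j z).
    { unfold j. rewrite Ha. unfold z. rewrite p2_npair.
      replace (a + (i + 4))%nat with (S (S (a + S (S i)))) by lia. simpl. lra. }
    rewrite Hj, Ha in *. pose proof (half_pow_pos (j z)).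
    enough (dec_rat (q z) <= INR (cn a (h z)) * (/2) ^ h z + 2 * (/2) ^ j z).
    { apply Rabs_le_between in Hq. lra. }
    assert (Hd : 0 <= INR (p2 (p1 (q z))) / INR (S (p2 (q z)))).
    { apply Rmult_le_pos; [apply pos_INR|]. apply Rlt_le, Rinv_0_lt_compat, lt_0_INR. lia. }
    assert (Hc : 0 <= INR (cn a (h z)) * (/2) ^ h z).
    { apply Rmult_le_pos; [apply pos_INR|]. apply Rlt_le, half_pow_pos. }
    rewrite dec_rat_eq.
    destruct (Nat.eqb_spec (p1 (p1 (q z))) 0) as [E|E].
    + destruct Hspec as [Hs|Hs]; [contradiction|]. unfold Rdiv in *. lra.
    + unfold Rdiv in *. lra.
Qed.

(** * Clopen approximations and captured strings *)

Section Clopen_approximation.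
Context (F : str -> str -> Prop) (St : nat -> nat -> nat -> Prop) (cn : nat -> nat -> nat)
  (T : nat -> nat -> nat) (HF : turing_functional F) (HSt : staging (gen F) St cn)
  (HTc : computable_fun (fun z => T (p1 z) (p2 z)))
  (HT : forall a i, lam (level (gen F) a) <=
     lam (cylset (fun s => St a (T a i) (code_str s))) + (/2) ^ (a + S (S i))).

Definition clopen_part (a i : nat) : cantor -> Prop :=
  cylset (fun s => St a (T a i) (code_str s)).

(** A decidable form of disjointness from the clopen part, meant for strings of length at least
    [T a i]: the cylinder of such a string lies entirely inside or entirely outside. The bound on
    [s] omits nothing of the stage, by [stage_bounded]. *)
Definition avoids (a i r : nat) : Prop :=
  forall s, (s < T a i)%nat -> ~ (St a (T a i) s /\ nprefix s r).

Lemma avoids_spec a i r X :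
  (T a i <= length r)%nat -> pre r X -> avoids a i (code_str r) <-> ~ clopen_part a i X.
Proof.
  intros Hr HX. split.
  - intros H [s [Hs HsX]]. apply (H (code_str s)); [now apply (stage_bounded _ _ _ HSt) in Hs|].
    split; [exact Hs|]. apply nprefix_code, pre_pre_spre with X; auto.
    apply (stage_length HSt) in Hs. lia.
  - intros H s _ [Hs Hn]. apply H. exists (decode_str s). rewrite code_decode.
    split; [exact Hs|]. apply pre_spre with r; [|exact HX].
    apply nprefix_code. now rewrite code_decode.
Qed.

Lemma clopen_part_incl a i X : clopen_part a i X -> level (gen F) a X.
Proof. intros H. apply (stage_cylset HSt). now exists (T a i). Qed.

(** An open set minus a clopen set is open, and it is enumerated here by long strings. The
    inequality [2 ^ T a i <= S r] says that the string coded by [r] has length at least [T a i]. *)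
Definition remainder_at (i a r : nat) : Prop :=
  exists s, gen F a s /\ nprefix s r /\ (2 ^ T a i <= S r)%nat /\ avoids a i r.

Definition remainder (i r : nat) : Prop := exists a, remainder_at i a r.

Lemma le_length_code n s : (2 ^ n <= S (code_str s))%nat <-> (n <= length s)%nat.
Proof.
  rewrite <- num_code. pose proof (num_bounds s) as [H1 H2]. split; intros H.
  - destruct (le_lt_dec n (length s)); [assumption|].
    pose proof (Nat.pow_le_mono_r 2 (S (length s)) n). lia.
  - apply Nat.le_trans with (2 ^ length s)%nat; [|exact H1].
    apply Nat.pow_le_mono_r; lia.
Qed.

Lemma remainder_at_spec i a X :
  level (fun a' => remainder_at i a') a X <-> level (gen F) a X /\ ~ clopen_part a i X.
Proof.
  split.
  - intros [r [[s [Hs [Hn [Hl Ha]]]] HX]]. apply le_length_code in Hl. split.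
    + exists (decode_str s). rewrite code_decode. split; [exact Hs|].
      apply pre_spre with r; [|exact HX]. apply nprefix_code. now rewrite code_decode.
    + now apply (avoids_spec a i r X).
  - intros [[s [Hs HX]] HC].
    exists (take X (T a i + length s)). split; [|apply pre_take].
    exists (code_str s). split; [exact Hs|]. split; [|split].
    + apply nprefix_code, spre_take; [exact HX|lia].
    + apply le_length_code. rewrite length_take. lia.
    + apply (avoids_spec a i _ X); auto using pre_take. rewrite length_take. lia.
Qed.

(** By additivity the part belonging to [a] has measure at most [2^-(a+i+2)], the error guaranteed
    by [HT]. Summing over all codes [a] gives the bound. *)
Lemma lam_remainder i : lam (level remainder i) <= (/2) ^ S i.
Proof.
  eapply Rle_trans;
    [apply (lam_mono _ (fun X => exists a, level (fun a' => remainder_at i a') a X))|].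
  - apply open_cylset.
  - intros X [r [[a H] HX]]. exists a, r. auto.
  - apply lam_countable_union; [intros a; apply open_cylset|].
    intros n. eapply Rle_trans; [|apply (rsum_half_pow (S i) n)].
    apply rsum_le. intros a.
    assert (H : lam (level (fun a' => remainder_at i a') a) + lam (clopen_part a i) <=
                lam (level (gen F) a)).
    { eapply Rle_trans; [apply lam_disjoint_ge; try apply open_cylset|].
      - intros X H. apply remainder_at_spec in H. tauto.
      - apply lam_mono; [apply open_or; apply open_cylset|].
        intros X [H|H]; [now apply remainder_at_spec in H|now apply clopen_part_incl in H]. }
    specialize (HT a i). unfold clopen_part in H. lra.
Qed.

Lemma rdec_avoids f g h :
  computable_fun f -> computable_fun g -> computable_fun h ->
  rdec (fun x => avoids (f x) (g x) (h x)).
Proof.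
  apply (rdec_app3 avoids). unfold avoids.
  assert (Hc : forall u v, computable_fun u -> computable_fun v ->
             computable_fun (fun z => T (u z) (v z))).
  { intros u v. now apply (computable_app2 T). }
  apply (rdec_ball (fun s z => ~ (St (p1 z) (T (p1 z) (p1 (p2 z))) s /\ nprefix s (p2 (p2 z)))));
    [|apply Hc; solve_computable].
  apply rdec_not, rdec_and; [|apply rdec_nprefix; solve_computable].
  apply (rdec_app3 St _ _ _ (stage_dec _ _ _ HSt)); try apply Hc; solve_computable.
Qed.

Lemma sigma1_remainder : sigma1 (fun z => remainder (p1 z) (p2 z)).
Proof.
  unfold remainder, remainder_at.
  apply (sigma1_ex (fun a z => exists s, gen F a s /\ nprefix s (p2 z) /\
    (2 ^ T a (p1 z) <= S (p2 z))%nat /\ avoids a (p1 z) (p2 z))).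
  apply (sigma1_ex (fun s z => gen F (p1 z) s /\ nprefix s (p2 (p2 z)) /\
    (2 ^ T (p1 z) (p1 (p2 z)) <= S (p2 (p2 z)))%nat /\
    avoids (p1 z) (p1 (p2 z)) (p2 (p2 z)))).
  apply sigma1_and.
  - apply (sigma1_app2 (gen F) _ _ (sigma1_gen F HF)); solve_computable.
  - apply sigma1_rdec. apply rdec_and; [apply rdec_nprefix; solve_computable|].
    apply rdec_and; [|apply rdec_avoids; solve_computable].
    apply rdec_le; [|solve_computable]. apply computable_pow2.
    apply (computable_app2 T _ _ HTc); solve_computable.
Qed.

(** * Captured strings and the compactness dichotomy *)

Context (U : nat -> nat -> Prop) (HUc : sigma1 (fun z => U (p1 z) (p2 z)))
  (HU : forall i, lam (level U i) <= (/2) ^ S i).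

Definition joint (i r : nat) : Prop := U i r \/ remainder i r.

Lemma level_joint i X : level joint i X <-> level U i X \/ level remainder i X.
Proof.
  split.
  - intros [r [[H|H] HX]]; [left|right]; now exists r.
  - intros [[r [H HX]]|[r [H HX]]]; exists r; (split; [|exact HX]); [now left|now right].
Qed.

Lemma lam_joint i : lam (level joint i) <= (/2) ^ i.
Proof.
  rewrite (lam_ext _ _ (level_joint i)).
  eapply Rle_trans; [apply lam_or_le; apply open_cylset|].
  specialize (HU i). pose proof (lam_remainder i). simpl in *. lra.
Qed.

(** The inclusion of the clopen part in the joint test, written as a finite check at some depth [n]
    so that it is visibly c.e. That such a depth exists is compactness, used in [captured_spec]. *)
Definition captured (i a : nat) : Prop :=
  exists n, (T a i <= n)%nat /\
    forall k, (k < 2 ^ n)%nat ->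
      avoids a i (pred (2 ^ n + k)) \/ exists u, nprefix u (pred (2 ^ n + k)) /\ joint i u.

Lemma captured_spec i a :
  captured i a <-> forall X, clopen_part a i X -> level joint i X.
Proof.
  split.
  - intros [n [HTn H]] X HX. set (r := take X n).
    pose proof (num_bounds r) as Hb. rewrite num_code in Hb.
    unfold r in Hb at 1 4. rewrite length_take in Hb. simpl in Hb.
    (* This number is the rank of [r] among the strings of length [n]. *)
    destruct (H (S (code_str r) - 2 ^ n)%nat) as [Hk|[u [Hu HJ]]]; [lia| |];
      replace (pred (2 ^ n + (S (code_str r) - 2 ^ n))) with (code_str r) in * by lia.
    + exfalso. apply (avoids_spec a i r X) in Hk; auto; [|apply pre_take].
      unfold r. now rewrite length_take.
    + exists (decode_str u). rewrite code_decode. split; [exact HJ|].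
      apply pre_spre with r; [|apply pre_take]. apply nprefix_code. now rewrite code_decode.
  - intros H.
    destruct (heine_borel (fun n s => (T a i <= length s)%nat /\
      (avoids a i (code_str s) \/ has_prefix (fun u => joint i (code_str u)) s)))
      as [n Hn].
    + intros n s b [Hl Hs]. split; [rewrite length_app; lia|].
      destruct Hs as [Hs|Hs]; [left|right; now apply has_prefix_upward].
      destruct (pre_inhabited (s ++ [b])) as [X HX].
      apply (avoids_spec a i _ X); [rewrite length_app; lia|exact HX|].
      apply (avoids_spec a i s X); auto. apply pre_spre with (s ++ [b]); auto. now exists [b].
    + auto.
    + intros X. exists 0%nat. destruct (classic (clopen_part a i X)) as [HX|HX].
      * destruct (H X HX) as [u [Hu HuX]]. exists (T a i + length u)%nat.
        rewrite length_take. split; [lia|]. right. exists u. split; [|exact Hu].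
        apply spre_take; [exact HuX|lia].
      * exists (T a i). rewrite length_take. split; [lia|]. left.
        apply (avoids_spec a i _ X); auto using pre_take. now rewrite length_take.
    + exists n. split.
      (* Any string of length [n] serves to read off [T a i <= n]. *)
      * destruct (Hn (repeat false n)) as [Hl _]; [apply repeat_length|].
        now rewrite repeat_length in Hl.
      * intros k Hk. set (m := pred (2 ^ n + k)).
        destruct (Hn (decode_str m)) as [_ Hs]; [now apply length_decode|].
        rewrite code_decode in Hs. destruct Hs as [Hs|[u [Hu HJ]]]; [now left|right].
        exists (code_str u). split; [|exact HJ].
        apply nprefix_code in Hu. now rewrite code_decode in Hu.
Qed.

Lemma level_gen_captured i a X : captured i a -> level (gen F) a X -> level joint i X.
Proof.
  intros Hc HX. destruct (classic (clopen_part a i X)) as [H|H].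
  - now apply (captured_spec i a).
  - apply level_joint. right.
    destruct (proj2 (remainder_at_spec i a X) (conj HX H)) as [r [Hr HrX]].
    exists r. split; [now exists a|exact HrX].
Qed.

Lemma sigma1_captured : sigma1 (fun z => captured (p1 z) (p2 z)).
Proof.
  unfold captured, joint.
  apply (sigma1_ex (fun n z => (T (p2 z) (p1 z) <= n)%nat /\
    forall k, (k < 2 ^ n)%nat -> avoids (p2 z) (p1 z) (pred (2 ^ n + k)) \/
      exists u, nprefix u (pred (2 ^ n + k)) /\ (U (p1 z) u \/ remainder (p1 z) u))).
  apply sigma1_and.
  { apply sigma1_rdec, rdec_le; [|solve_computable].
    apply (computable_app2 T _ _ HTc); solve_computable. }
  apply (sigma1_ball (fun k z =>
    avoids (p2 (p2 z)) (p1 (p2 z)) (pred (2 ^ p1 z + k)) \/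
    exists u, nprefix u (pred (2 ^ p1 z + k)) /\
      (U (p1 (p2 z)) u \/ remainder (p1 (p2 z)) u))); [|solve_computable].
  apply sigma1_or; [apply sigma1_rdec, rdec_avoids; solve_computable|].
  apply (sigma1_ex (fun u z => nprefix u (pred (2 ^ p1 (p2 z) + p1 z)) /\
      (U (p1 (p2 (p2 z))) u \/ remainder (p1 (p2 (p2 z))) u))).
  apply sigma1_and; [apply sigma1_rdec, rdec_nprefix; solve_computable|].
  apply sigma1_or.
  - apply (sigma1_app2 U _ _ HUc); solve_computable.
  - apply (sigma1_app2 remainder _ _ sigma1_remainder); solve_computable.
Qed.

(** The clopen parts along [Y] need not be nested, because each is chosen independently. Outside the
    joint test they coincide with the nested sets of inputs whose output extends the initial
    segments of [Y], and this suffices for compactness. *)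
Lemma captured_or_preimage Y i :
  (exists n, captured i (code_str (take Y n))) \/
  (exists Z, ~ level joint i Z /\ forall n, out_ext F Z (take Y n)).
Proof.
  apply NNPP. intros Hno. apply not_or_and in Hno as [Hcap Hpre].
  set (C := fun n => clopen_part (code_str (take Y n)) i).
  set (T' := fun n => T (code_str (take Y n)) i).
  assert (Hclosed : forall n X, out_ext F X (take Y n) -> ~ level joint i X -> C n X).
  { intros n X HX HJ. apply NNPP. intros HC. apply HJ. apply level_joint. right.
    apply (out_ext_gen F X _ HF) in HX.
    destruct (proj2 (remainder_at_spec i _ X) (conj HX HC)) as [r [Hr HrX]].
    exists r. split; [|exact HrX]. now exists (code_str (take Y n)). }
  destruct (heine_borel (fun n s => inside (level joint i) s \/
      exists m, (m <= n)%nat /\ inside (fun X => ~ C m X) s)) as [n Hn].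
  - intros n s b [H|[m [Hm H]]]; [left|right; exists m; split; [exact Hm|]];
      now apply inside_upward.
  - intros n s [H|[m [Hm H]]]; [now left|right]. exists m. split; [lia|exact H].
  - intros X. destruct (classic (level joint i X)) as [HJ|HJ].
    + destruct (open_cylset _ X HJ) as [k Hk]. exists 0%nat, k. now left.
    + assert (Hm : exists m, ~ C m X).
      { apply NNPP. intros Hall. apply Hpre. exists X. split; [exact HJ|]. intros m.
        apply (out_ext_gen F X _ HF). apply (clopen_part_incl _ i).
        apply NNPP. intros HC. apply Hall. now exists m. }
      destruct Hm as [m Hm]. exists m, (T' m). right. exists m. split; [lia|].
      intros Z HZ.
      (* Membership in [C m] depends only on the first [T' m] bits, so not lying in [C m] is an open
         condition. *)
      apply (avoids_spec _ i (take X (T' m)) Z); [rewrite length_take; unfold T'; lia|exact HZ|].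
      apply (avoids_spec _ i (take X (T' m)) X);
        [rewrite length_take; unfold T'; lia|apply pre_take|exact Hm].
  (* A point of [C n] outside the joint test would leave some [C m] with [m <= n]. But its output
     extends [take Y n] and hence [take Y m], which puts it back into [C m]. *)
  - apply Hcap. exists n. apply captured_spec. intros X HX.
    apply NNPP. intros HJ.
    destruct (Hn (take X n)) as [H|[m [Hm H]]]; [apply length_take| |].
    + apply HJ, H, pre_take.
    + apply (H X (pre_take X n)). apply Hclosed; [|exact HJ].
      destruct (take_le Y m n Hm) as [r Hr].
      apply out_ext_app with r. rewrite <- Hr.
      apply (out_ext_gen F X _ HF). now apply (clopen_part_incl _ i).
Qed.

End Clopen_approximation.

(** * Transfer of the test and inclusion of the images *)

Lemma image_MLR_incl (Phi Psi : str -> str -> Prop) :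
  turing_functional Phi -> turing_functional Psi ->
  (forall s, lam_Phi Phi s = lam_Phi Psi s) ->
  computable_semimeasure (lam_Phi Psi) ->
  forall Y, image Phi MLR Y -> image Psi MLR Y.
Proof.
  intros HPhi HPsi Heq [_ [g [Hg Happ]]] Y [X [HX [_ HXY]]].
  destruct (staging_exists (gen Psi) (sigma1_gen Psi HPsi)) as [St [cn HSt]].
  destruct (approximation_time Psi g St cn HPsi HSt Hg Happ) as [T [HTc HT]].
  destruct universal_test as [U [HUc [HU HUniv]]].
  set (G := captured Psi St T U).
  (* A preimage outside a single level of the joint test is random, since it is outside that level
     of the universal test. If there is none at any level, every level captures an initial segment
     of [Y]. *)
  destruct (classic (exists i Z, ~ level (joint Psi St T U) i Z /\
                                 forall n, out_ext Psi Z (take Y n))) as [[i [Z [HZ HZY]]]|Hno].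
  - assert (Hout : forall k, out Psi Z k (Y k)).
    { intros k. specialize (HZY (S k) k). rewrite length_take, nth_take in HZY by lia.
      apply HZY. lia. }
    exists Z. split; [|split; [intros k; now exists (Y k)|exact Hout]].
    apply HUniv with i. intros H. apply HZ, level_joint. now left.
  - exfalso.
    (* The captured strings are computed from [Psi], but the inputs enumerated are those on which
       [Phi] produces such a string. *)
    set (W := fun n => exists a, G (p1 n) a /\ gen Phi a (p2 n)).
    assert (HW : forall i Z, cylset (fun s => W (npair i (code_str s))) Z <->
                   exists v, G i (code_str v) /\ out_ext Phi Z v).
    { intros i Z. split.
      - intros [s [[a [Ha Hs]] HZ]]. rewrite p1_npair in Ha. rewrite p2_npair in Hs.
        exists (decode_str a). rewrite code_decode. split; [exact Ha|].
        apply out_ext_gen; [exact HPhi|]. rewrite code_decode. now exists s.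
      - intros [v [Hv HZ]]. apply out_ext_gen in HZ as [s [Hs HZ]]; [|exact HPhi].
        exists s. split; [|exact HZ]. exists (code_str v). now rewrite p1_npair, p2_npair. }
    apply (HX W).
    + split.
      * apply sigma1_ce.
        apply (sigma1_ex (fun a n => G (p1 n) a /\ gen Phi a (p2 n))).
        apply sigma1_and.
        -- apply (sigma1_app2 G); [|solve_computable..].
           now apply (sigma1_captured Psi St cn T HPsi HSt HTc U HUc).
        -- apply (sigma1_app2 (gen Phi) _ _ (sigma1_gen Phi HPhi)); solve_computable.
      * intros i. eapply Rle_trans;
          [apply (lam_mono _ (fun Z => exists n, image_cover Phi (G i) [] n Z))|].
        -- apply open_cylset.
        -- intros Z HZ. apply HW in HZ as [v [Hv HZ]]. exists (length v).
           now apply image_cover_intro.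
        -- apply lam_increasing_union.
           ++ intros n. now apply open_image_cover.
           ++ intros n Z. apply image_cover_step.
           (* This is where equality of the induced semi-measures enters. On the side of [Psi] the
              covered set lies inside the joint test, whose measure is known. *)
           ++ intros n. eapply Rle_trans; [now apply (lam_image_cover Phi Psi)|].
              eapply Rle_trans; [|apply (lam_joint Psi St cn T HSt HT U HU i)].
              apply lam_mono; [now apply open_image_cover|].
              intros Z HZ. apply image_cover_elim in HZ as [v [Hv HZ]].
              apply (level_gen_captured Psi St cn T HSt U i (code_str v)); [exact Hv|].
              now apply out_ext_gen.
    + intros i. apply HW.
      destruct (captured_or_preimage Psi St cn T HPsi HSt U Y i) as [[n Hn]|HZ].
      * exists (take Y n). split; [exact Hn|].
        intros k Hk. rewrite length_take in Hk. rewrite nth_take by exact Hk. apply HXY.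
      * exfalso. apply Hno. now exists i.
Qed.

Theorem theorem3p1 (Phi Psi : str -> str -> Prop) :
  turing_functional Phi -> turing_functional Psi ->
  (forall s, lam_Phi Phi s = lam_Phi Psi s) ->
  computable_semimeasure (lam_Phi Phi) ->
  forall Y, image Phi MLR Y <-> image Psi MLR Y.
Proof.
  intros HPhi HPsi Heq Hc Y.
  assert (E : lam_Phi Phi = lam_Phi Psi) by (apply functional_extensionality, Heq).
  split; apply image_MLR_incl; auto. now rewrite <- E.
Qed.
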